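(* Assume (A-f), (A-J), (A-TW), (A-5), (A-nd), and $J\in\mathbb{B}^\alpha_{1,\infty}(\Omega;\delta)$ for some $\alpha\in(0,1)$; let $(\phi,c)$ be as in (A-TW). Let $u(t,x)$ be the unique bounded entire solution of $\partial_tu=Lu+f(u)$ in $\mathbb{R}\times\overline\Omega$ with $|u(t,x)-\phi(x_1+ct)|\to0$ as $t\to-\infty$ uniformly in $x\in\overline\Omega$, and let $u_\infty\in C(\overline\Omega)$ be a solution of $Lu_\infty+f(u_\infty)=0$ in $\overline\Omega$, $u_\infty(x)\to1$ as $|x|\to\infty$, such that $|u(t,x)-u_\infty(x)\phi(x_1+ct)|\to0$ as $t\to+\infty$ locally uniformly in $x\in\overline\Omega$. Then $$\sup_{(t,x)\in\mathbb{R}\times\overline\Omega,\ x_1+ct\ge A}|u(t,x)-u_\infty(x)|\to0\quad\text{and}\quad\sup_{(t,x)\in\mathbb{R}\times\overline\Omega,\ x_1+ct\le-A}u(t,x)\to0\quad\text{as }A\to\infty.$$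
   Context: $K\subset\mathbb{R}^N$ is compact and $\Omega:=\mathbb{R}^N\setminus K$ is connected. A distance $\delta$ on $E\subset\mathbb{R}^N$ is quasi-Euclidean if $\delta(x,y)=|x-y|$ whenever $[x,y]\subset E$ and $\delta(x,y)\ge|x-y|$ for all $x,y\in E$; $\delta$ is a quasi-Euclidean distance on $\overline\Omega$. For measurable $J:[0,\infty)\to[0,\infty)$ with $|\mathrm{supp}(J)|>0$ and $x\in\overline\Omega$, $\Pi_0(J,x)=\{x\}$, $\Pi_{j+1}(J,x)=\bigcup_{z\in\Pi_j(J,x)}\mathrm{supp}(J(\delta(\cdot,z)))$; $(\Omega,\delta)$ has the $J$-covering property if $\overline\Omega=\bigcup_{j}\Pi_j(J,x)$ for all $x\in\overline\Omega$. Notation: $J_{\mathrm{rad}}(z)=J(|z|)$, $\mathcal{J}^\delta(x)=\int_\Omega J(\delta(x,z))dz$, $J_1(s)=\int_{\mathbb{R}^{N-1}}J_{\mathrm{rad}}(s,y')dy'$, $Lu(x)=\int_\Omega J(\delta(x,y))(u(y)-u(x))dy$; $x=(x_1,x')$. (A-f): $f:[0,1]\to\mathbb{R}$, $f\in C^{1,1}([0,1])$, $\exists\theta\in(0,1)$: $f(0)=f(\theta)=f(1)=0$, $f<0$ on $(0,\theta)$, $f>0$ on $(\theta,1)$, $f'(0)<0$, $f'(\theta)>0$, $f'(1)<0$. (A-J): $J$ measurable, compactly supported, $|\mathrm{supp}J|>0$; $(\Omega,\delta)$ has the $J$-covering property; $\int_{\mathbb{R}^N}J_{\mathrm{rad}}=1$;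 for every $y\in\overline\Omega$, $\|J(\delta(y,\cdot))-J(\delta(z,\cdot))\|_{L^1(\Omega)}\to0$ as $z\to y$; $\mathcal{J}^\delta\in L^\infty(\Omega)$. (A-TW): there exist increasing $\phi\in C(\mathbb{R})$, $c>0$ with $c\phi'=J_1*\phi-\phi+f(\phi)$, $\phi(-\infty)=0$, $\phi(+\infty)=1$. (A-5): $J_{\mathrm{rad}}\in W^{1,1}(\mathbb{R}^N)$, $\max_{[0,1]}f'<1$, $\int_0^1f>0$. (A-nd): $\max_{[0,1]}f'<\inf_\Omega\mathcal{J}^\delta$. $\mathbb{B}^\alpha_{1,\infty}(\Omega;\delta)$: $g:[0,\infty)\to\mathbb{R}$ with $g(|\cdot|)\in L^1(\mathbb{R}^N)$ and $\sup_{y\ne z\in\Omega}\|g(\delta(y,\cdot))-g(\delta(z,\cdot))\|_{L^1(\Omega)}/|y-z|^\alpha<\infty$. *)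

(* Defs.v *)
From mathcomp Require Import all_boot all_order all_algebra.
From mathcomp Require Import all_classical all_reals all_analysis.
Import Order.TTheory GRing.Theory Num.Theory.
Import numFieldNormedType.Exports.
Set Implicit Arguments. Unset Strict Implicit. Unset Printing Implicit Defensive.
Local Open Scope ring_scope.
Local Open Scope classical_set_scope.

Section Defs.
Variable R : realType.

(* Euclidean norm |x| on R^n (mathcomp's default norm on 'rV is the max norm) *)
Definition enorm n (x : 'rV[R]_n) : R := Num.sqrt (\sum_(i < n) x ord0 i ^+ 2).

Definition segm n (x y : 'rV[R]_n) : set 'rV[R]_n :=
  [set (1 - t) *: x + t *: y | t in `[0%R, 1%R]].

Definition x1 n (x : 'rV[R]_n.+1) : R := x ord0 ord0.
Definition joinv n (s : R) (y : 'rV[R]_n) : 'rV[R]_n.+1 := row_mx (\row_(_ < 1) s) y.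

(* Lebesgue integral over R^n of a nonnegative (extended) function,
   defined as the iterated one-dimensional Lebesgue integral (Tonelli). *)
Fixpoint iint (n : nat) : ('rV[R]_n -> \bar R) -> \bar R :=
  match n with
  | 0 => fun g => g 0
  | m.+1 => fun g =>
      (\int[@lebesgue_measure R]_(t in setT)
         iint (fun v : 'rV[R]_m => g (joinv t v)))%E
  end.

Definition intN n (A : set 'rV[R]_n) (g : 'rV[R]_n -> \bar R) : \bar R :=
  iint (fun x => if x \in A then g x else 0%E).

Definition sintN n (A : set 'rV[R]_n) (g : 'rV[R]_n -> R) : \bar R :=
  (intN A (fun x => (Num.max (g x) 0)%:E) - intN A (fun x => (Num.max (- g x) 0)%:E))%E.

Definition nullN n (A : set 'rV[R]_n) : Prop :=
  intN A (fun _ => 1%E) = 0%E.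

Definition is_distance_on n (E : set 'rV[R]_n) (delta : 'rV[R]_n -> 'rV[R]_n -> R) :=
  forall x y z, E x -> E y -> E z ->
    [/\ 0 <= delta x y, delta x y = 0 <-> x = y, delta x y = delta y x
      & delta x z <= delta x y + delta y z].

Definition quasi_euclidean n (E : set 'rV[R]_n) (delta : 'rV[R]_n -> 'rV[R]_n -> R) :=
  is_distance_on E delta /\
  forall x y, E x -> E y ->
    (segm x y `<=` E -> delta x y = enorm (x - y)) /\ enorm (x - y) <= delta x y.

Definition suppJ (J : R -> R) : set R := closure [set s | 0 <= s /\ J s != 0].

Definition suppJd n (Ob : set 'rV[R]_n) (J : R -> R) (delta : 'rV[R]_n -> 'rV[R]_n -> R)
  (z : 'rV[R]_n) : set 'rV[R]_n := closure [set x | Ob x /\ J (delta x z) != 0].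

Fixpoint PiJ n (Ob : set 'rV[R]_n) (J : R -> R) (delta : 'rV[R]_n -> 'rV[R]_n -> R)
  (j : nat) (x : 'rV[R]_n) : set 'rV[R]_n :=
  match j with
  | 0 => [set x]
  | j'.+1 => \bigcup_(z in PiJ Ob J delta j' x) suppJd Ob J delta z
  end.

Definition J_covering n (Om : set 'rV[R]_n) J delta :=
  forall x, closure Om x -> closure Om = \bigcup_(j in setT) PiJ (closure Om) J delta j x.

Definition Jrad n (J : R -> R) (z : 'rV[R]_n) : R := J (enorm z).

Definition calJ n (Om : set 'rV[R]_n) (J : R -> R) delta (x : 'rV[R]_n) : \bar R :=
  intN Om (fun z => (J (delta x z))%:E).

Definition L1dist n (Om : set 'rV[R]_n) (J : R -> R) delta (y z : 'rV[R]_n) : \bar R :=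
  intN Om (fun x => `|J (delta y x) - J (delta z x)|%:E).

(* J_1(s) = int_{R^{N-1}} J_rad(s, y') dy'   (here N = n.+1) *)
Definition J1 n (J : R -> R) (s : R) : \bar R :=
  iint (fun y : 'rV[R]_n => (Jrad J (joinv s y))%:E).

Definition Lop n (Om : set 'rV[R]_n) (J : R -> R) delta (u : 'rV[R]_n -> R) (x : 'rV[R]_n) : \bar R :=
  sintN Om (fun y => J (delta x y) * (u y - u x)).

Fixpoint Dn n (vs : seq 'rV[R]_n) (psi : 'rV[R]_n -> R) : 'rV[R]_n -> R :=
  match vs with
  | [::] => psi
  | v :: vs' => fun x => 'D_v (Dn vs' psi) x
  end.

Definition test_fun n (psi : 'rV[R]_n -> R) : Prop :=
  (forall vs v x, derivable (Dn vs psi) x v) /\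
  (forall vs, continuous (Dn vs psi)) /\
  exists B : R, forall x, B < enorm x -> psi x = 0.

Definition evec n (i : 'I_n) : 'rV[R]_n := \row_(j < n) (if j == i then 1 else 0).

Definition W11 n (g : 'rV[R]_n -> R) : Prop :=
  (iint (fun x => `|g x|%:E) < +oo)%E /\
  forall i : 'I_n, exists gi : 'rV[R]_n -> R,
    (iint (fun x => `|gi x|%:E) < +oo)%E /\
    forall psi, test_fun psi ->
      sintN setT (fun x => g x * 'D_(evec i) psi x) =
      oppe (sintN setT (fun x => gi x * psi x)).

Definition Besov n (Om : set 'rV[R]_n) (alpha : R) (J : R -> R) delta : Prop :=
  (iint (fun z : 'rV[R]_n => `|Jrad J z|%:E) < +oo)%E /\
  exists C : R, forall y z, Om y -> Om z -> y != z ->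
    (L1dist Om J delta y z <= (C * enorm (y - z) `^ alpha)%:E)%E.

(* Lebesgue measurability on R (completed Lebesgue sigma-algebra) *)
Definition LebR := caratheodory_type (R:=R) (wlength (@idfun R))^*%mu.
Definition leb_measurable (J : R -> R) : Prop := @measurable_fun _ _ LebR R setT J.

Definition A_f (f f' : R -> R) (theta : R) : Prop :=
  (* f in C^{1,1}([0,1]) with derivative f' *)
  (forall x, 0 <= x <= 1 ->
     (fun y => (f y - f x) / (y - x)) @ within [set y | 0 <= y <= 1 /\ y != x] (nbhs x)
       --> f' x) /\
  (exists L : R, forall x y, 0 <= x <= 1 -> 0 <= y <= 1 -> `|f' x - f' y| <= L * `|x - y|) /\
  0 < theta < 1 /\ f 0 = 0 /\ f theta = 0 /\ f 1 = 0 /\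
  (forall s, 0 < s < theta -> f s < 0) /\ (forall s, theta < s < 1 -> 0 < f s) /\
  f' 0 < 0 /\ 0 < f' theta /\ f' 1 < 0.

Definition A_J n (Om : set 'rV[R]_n.+1) (J : R -> R) delta : Prop :=
  leb_measurable J /\ (forall s, 0 <= s -> 0 <= J s) /\
  (exists B : R, suppJ J `<=` [set s | s <= B]) /\
  (0 < lebesgue_measure (suppJ J))%E /\
  J_covering Om J delta /\
  iint (fun z : 'rV[R]_n.+1 => (Jrad J z)%:E) = 1%E /\
  (forall y, closure Om y -> forall e : R, 0 < e -> exists2 d : R, 0 < d &
     forall z, closure Om z -> enorm (z - y) < d -> (L1dist Om J delta y z < e%:E)%E) /\
  (exists M : R, nullN [set x | Om x /\ (M%:E < calJ Om J delta x)%E]).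

Definition A_TW n (J f : R -> R) (phi : R -> R) (c : R) : Prop :=
  0 < c /\ continuous phi /\ {homo phi : x y / x < y} /\
  (forall x, derivable phi x 1) /\
  (forall x, ((c * 'D_1 phi x)%:E =
     \int[@lebesgue_measure R]_(y in setT) (J1 n J (x - y) * (phi y)%:E)
     - (phi x)%:E + (f (phi x))%:E)%E) /\
  phi @ -oo --> (0:R) /\ phi @ +oo --> (1:R).

Definition A_5 n (J f f' : R -> R) : Prop :=
  W11 (Jrad (n:=n.+1) J) /\ sup [set f' s | s in `[0%R, 1%R]] < 1 /\
  (0 < \int[@lebesgue_measure R]_(s in `[0%R, 1%R]) (f s)%:E)%E.

Definition A_nd n (Om : set 'rV[R]_n) (J f' : R -> R) delta : Prop :=
  ((sup [set f' s | s in `[0%R, 1%R]])%:E < ereal_inf [set calJ Om J delta x | x in Om])%E.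

End Defs.

(* Main.v *)
(* Far from the obstacle the kernel is J(|x - y|), so functions of (t, x_1) see the
   one-dimensional operator of the travelling wave. The solution u is enclosed, for
   t >= T0 and |x| >= R0, between

     phi(x_1 + c t - sigma - s(t)) - q   and   phi(x_1 + c t + sigma + s(t)) + q,
     q(t, x_1) = a (b(x_1 / rho) + b((t - T0) / rho)),   b(y) = 1 / (1 + y^2),

   with T0 so negative that |u - phi| <= a at time T0. Where phi is close to 0 or 1 the
   stability f'(0), f'(1) < 0 absorbs q; in the transition zone |x_1 + c t| is bounded, so q
   is integrable in time there and is absorbed by the bounded shift s, because phi' is
   bounded below on compact sets. The part b(x_1 / rho) of q does not decay in time: near
   the obstacle it dominates the error 1 - u, which is only known to be eventually small
   and for which no rate is available. For the upper bound u <= 1 is enough there, once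
   sigma is large. The comparison principle needs only the monotonicity of the nonlocal
   operator. *)
Require Import Defs.
From mathcomp Require Import all_boot all_order all_algebra.
From mathcomp Require Import all_classical all_reals all_analysis.
From mathcomp Require Import measurable_realfun ring lra.
Import Order.TTheory GRing.Theory Num.Theory.
Import numFieldNormedType.Exports.
Local Open Scope ring_scope.
Local Open Scope classical_set_scope.

(** * Lower integrals on the line *)

Section LowerIntegral.
Context {R : realType}.
Local Open Scope ereal_scope.
Import HBNNSimple.
Local Notation mu := (@lebesgue_measure R).
Implicit Types F G : R -> \bar R.

(* The integral of a nonnegative function that need not be measurable is the supremum of
   the integrals of the simple functions below it; no measurability in space is assumed of
   the solution u, so Lop has to be handled as such a lower integral. *)
Lemma lower_integral_le F (X : \bar R) : (forall t, 0 <= F t) ->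
  (forall h : {nnsfun measurableTypeR R >-> R}, (forall t, (h t)%:E <= F t) ->
     \int[mu]_t (h t)%:E <= X) ->
  \int[mu]_t F t <= X.
Proof.
move=> F0 hX; rewrite ge0_integralTE//; apply: ge_ereal_sup => _ [h /= hF <-].
by have := hX h hF; rewrite integral_nnsfun// patch_setT.
Qed.

Lemma lower_integral_mono F G : (forall t, 0 <= F t) -> (forall t, F t <= G t) ->
  \int[mu]_t F t <= \int[mu]_t G t.
Proof.
move=> F0 FG; rewrite !ge0_integralTE//; last first.
  by move=> t; apply: le_trans (F0 t) (FG t).
apply: ge_ereal_sup => _ [h /= hF <-]; apply: ereal_sup_ubound.
by exists h => //= x; apply: le_trans (hF x) (FG x).
Qed.

Lemma lower_integralZl_le (k : R) F : (0 < k)%R -> (forall t, 0 <= F t) ->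
  k%:E * \int[mu]_t F t <= \int[mu]_t (k%:E * F t).
Proof.
move=> k0 F0; have ki : (0 < k^-1)%R by rewrite invr_gt0.
suff : \int[mu]_t F t <= (k^-1)%:E * \int[mu]_t (k%:E * F t).
  move=> /(lee_wpmul2l (x := k%:E)); rewrite lee_fin => /(_ (ltW k0)) /le_trans; apply.
  by rewrite muleA -EFinM divff ?gt_eqF// mul1e.
apply: lower_integral_le => // h hF.
have mh : measurable_fun [set: measurableTypeR R] (EFin \o h).
  exact/measurable_EFinP.
have -> : \int[mu]_t (h t)%:E = k^-1%:E * \int[mu]_t (k%:E * (h t)%:E).
  rewrite ge0_integralZl_EFin//; last 2 first.
    by move=> t _; rewrite lee_fin.
    exact: ltW.
  by rewrite muleA -EFinM mulVf ?gt_eqF// mul1e.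
apply: lee_wpmul2l; first by rewrite lee_fin ltW.
apply: lower_integral_mono => t; first by rewrite mule_ge0// lee_fin// ltW.
by apply: lee_wpmul2l => //; rewrite lee_fin ltW.
Qed.

Lemma lower_integralZl (k : R) F : (0 <= k)%R -> (forall t, 0 <= F t) ->
  \int[mu]_t (k%:E * F t) = k%:E * \int[mu]_t F t.
Proof.
rewrite le_eqVlt => /predU1P[<- F0|k0 F0].
  by rewrite mul0e integral0_eq// => t _; rewrite mul0e.
apply/eqP; rewrite eq_le lower_integralZl_le// andbT.
have ki : (0 < k^-1)%R by rewrite invr_gt0.
have := @lower_integralZl_le k^-1 (fun t => k%:E * F t) ki.
have -> : \int[mu]_t (k^-1%:E * (k%:E * F t)) = \int[mu]_t F t.
  by apply: eq_integral => t _; rewrite muleA -EFinM mulVf ?gt_eqF// mul1e.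
have kF t : 0 <= k%:E * F t by rewrite mule_ge0// lee_fin ltW.
move=> /(_ kF) /(lee_wpmul2l (x := k%:E)); rewrite lee_fin => /(_ (ltW k0)).
by rewrite muleA -EFinM divff ?gt_eqF// mul1e.
Qed.

Lemma lower_integral_ae F G (N : set R) : (forall t, 0 <= F t) -> (forall t, 0 <= G t) ->
  mu.-negligible N -> (forall t, ~ N t -> F t = G t) ->
  \int[mu]_t F t = \int[mu]_t G t.
Proof.
move=> + + [M [mM M0 NM]].
have main A B : (forall t, 0 <= A t) -> (forall t, 0 <= B t) ->
    (forall t, ~ N t -> A t = B t) -> \int[mu]_t A t <= \int[mu]_t B t.
  move=> A0 B0 AB; apply: lower_integral_le => // h hA.
  pose h' (t : measurableTypeR R) := (h t)%:E * (\1_(~` M) t)%:E.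
  have mh : measurable_fun [set: measurableTypeR R] (EFin \o h).
    exact/measurable_EFinP.
  have h'0 t : 0 <= h' t.
    by rewrite /h' mule_ge0// lee_fin// indicE; case: (_ \in _).
  rewrite (@ge0_ae_eq_integral _ _ _ mu setT _ h')//.
  - apply: lower_integral_mono => // t; rewrite /h' indicE.
    have [Mt|Mt] := pselect (M t); first by rewrite memNset ?mule0//; apply.
    by rewrite mem_set// mule1 (le_trans (hA t))// AB// => /NM.
  - apply: emeasurable_funM => //; apply/measurable_EFinP.
    exact: measurable_indic (measurableC mM).
  - by move=> t _; rewrite lee_fin.
  - exists M; split => // t /= nt; apply: contrapT => Mt; apply: nt => _.
    by rewrite /h' indicE mem_set// mule1.
move=> F0 G0 FG; apply/eqP; rewrite eq_le; apply/andP; split; apply: main => //.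
by move=> t /FG.
Qed.

Lemma lebesgue_measure_reflect (a : R) (A : set R) : measurable A ->
  pushforward mu (fun t : measurableTypeR R => (a - t)%R : measurableTypeR R) A = mu A.
Proof.
have ma : measurable_fun setT (fun t : measurableTypeR R => (a - t)%R : measurableTypeR R).
  exact: measurable_funB.
move=> mA; apply/esym/lebesgue_measure_unique => //= _ [[x y]] _ <-.
rewrite /pushforward (_ : _ @^-1` _ = `[(a - y)%R, (a - x)%R[%classic).
  rewrite !lebesgue_measure_itv/= !lte_fin ltrD2l ltrN2.
  case: ifP => // _; rewrite -!EFinB; congr EFin; ring.
by apply/seteqP; split => t /=; rewrite !in_itv/= => /andP[h1 h2]; apply/andP; split; lra.
Qed.

Lemma lower_integral_reflect (a : R) F : (forall t, 0 <= F t) ->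
  \int[mu]_t F (a - t)%R = \int[mu]_t F t.
Proof.
have main G : (forall t, 0 <= G t) -> \int[mu]_t G t <= \int[mu]_t G (a - t)%R.
  move=> G0; apply: lower_integral_le => // h hG.
  have ma : measurable_fun setT (fun t : measurableTypeR R => (a - t)%R : measurableTypeR R).
    exact: measurable_funB.
  have mh : measurable_fun [set: measurableTypeR R] (EFin \o h).
    exact/measurable_EFinP.
  have := @ge0_integral_pushforward _ _ _ _ R _ ma mu setT _ measurableT mh.
  rewrite preimage_setT => H.
  rewrite [leLHS](_ : _ = \int[mu]_t (h (a - t)%R)%:E).
    by apply: lower_integral_mono => t; rewrite ?lee_fin.
  rewrite -[RHS]H; last by move=> y _; rewrite lee_fin.
  by apply: eq_measure_integral => //= A mA _; rewrite lebesgue_measure_reflect.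
move=> F0; apply/eqP; rewrite eq_le main// andbT.
rewrite (le_trans (main _ _))//.
by apply: lower_integral_mono => // t; rewrite subKr.
Qed.

End LowerIntegral.

(** * Null sets and Borel versions *)

Section NullSets.
Context {R : realType}.
Local Notation mu := (@lebesgue_measure R).
Local Notation l := (wlength (@idfun R)).

Lemma negligible_expanding_preimage (D : set R) (g : R -> R) (C : R) (N : set R) :
  0 <= C -> (forall s t, D s -> D t -> `|s - t| <= C * `|g s - g t|) ->
  mu.-negligible N -> mu.-negligible (D `&` g @^-1` N).
Proof.
move=> C0 Dg /negligible_outer_measure N0; apply/negligible_outer_measure.
apply/eqP; rewrite eq_le outer_measure_ge0 andbT.
have C1 : 0 < 2 * C + 1 by lra.
apply/lee_addgt0Pr => e e0; rewrite add0e.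
have [_ [A [/= mA NA] <-]] : exists2 x,
    [set (\sum_(0 <= k <oo) l (A k))%E | A in @measurable_cover _ (ocitv_type R) N] x &
    (x < (l^* N)%mu + (e / (2 * C + 1))%:E)%E.
  apply: lb_ereal_inf_adherent; first by rewrite divr_gt0.
  by have -> : ereal_inf [set (\sum_(0 <= k <oo) l (A k))%E | A in
     @measurable_cover _ (ocitv_type R) N] = 0%E by exact: N0.
rewrite N0 add0e => Ae.
have -> : (e%:E = (2 * C + 1)%:E * (e / (2 * C + 1))%:E)%E.
  by rewrite -EFinM mulrCA divff ?mulr1// gt_eqF.
apply: (@le_trans _ _ ((2 * C + 1)%:E * \sum_(0 <= k <oo) l (A k))%E); last first.
  by apply: lee_wpmul2l; [rewrite lee_fin ltW|exact: ltW].
rewrite -nneseriesZl; last first.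
  by move=> k _; exact: wlength_ge0.
pose F k := D `&` g @^-1` (A k).
apply: (@le_trans _ _ ((l^*)%mu (\bigcup_k F k))).
  apply: le_outer_measure => t [Dt /NA [k _ At]].
  by exists k.
apply: le_trans; first exact: (outer_measure_sigma_subadditive (l^*)%mu F).
apply: lee_nneseries => // k _.
have [[a b] _ Aab] := mA k.
have [[t0 [Dt0 At0]]|/set0P/negP/negPn/eqP F0] := pselect (F k !=set0); last first.
  by rewrite F0 outer_measure0 mule_ge0// ?lee_fin ?ltW// wlength_ge0.
move: At0; rewrite /= -Aab /= in_itv/= => /andP[at0 t0b].
have ab : a <= b by exact: ltW (lt_le_trans at0 t0b).
rewrite wlength_itv_bnd//=.
apply: (@le_trans _ _ (mu (`[t0 - C * (b - a), t0 + C * (b - a)]%classic : set R))).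
  apply: le_outer_measure => t [Dt]; rewrite /= -Aab /= !in_itv/= => /andP[agt gtb].
  rewrite -ler_distl; apply: le_trans (Dg _ _ Dt Dt0) _.
  apply: ler_wpM2l => //; rewrite ler_norml; lra.
have Cab : 0 <= C * (b - a) by rewrite mulr_ge0// subr_ge0.
rewrite lebesgue_measure_itv/= lte_fin; case: ifP => _.
  rewrite -EFinD -EFinM lee_fin; nra.
rewrite -EFinM lee_fin; nra.
Qed.

Lemma sqrt_sum_diff (a s t k : R) : 0 <= a -> 0 < k -> k^-1 <= s -> k^-1 <= t ->
  Num.sqrt (a + s ^+ 2) <= k -> Num.sqrt (a + t ^+ 2) <= k ->
  `|s - t| <= k ^+ 2 * `|Num.sqrt (a + s ^+ 2) - Num.sqrt (a + t ^+ 2)|.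
Proof.
move=> a0 k0 ks kt.
have ki : 0 < k^-1 by rewrite invr_gt0.
have kk : k * k^-1 = 1 by rewrite divff// gt_eqF.
have := sqr_sqrtr (_ : 0 <= a + s ^+ 2); rewrite addr_ge0 ?sqr_ge0// => /(_ isT).
have := sqr_sqrtr (_ : 0 <= a + t ^+ 2); rewrite addr_ge0 ?sqr_ge0// => /(_ isT).
have := sqrtr_ge0 (a + s ^+ 2); have := sqrtr_ge0 (a + t ^+ 2).
set x := Num.sqrt (a + s ^+ 2); set y := Num.sqrt (a + t ^+ 2).
move=> y0 x0 yE xE xk yk.
have E : (s - t) * (s + t) = (x - y) * (x + y).
  by rewrite -!subr_sqr xE yE; ring.
have st : 0 < s + t by lra.
have : `|s - t| * (s + t) = `|x - y| * (x + y).
  by rewrite -(ger0_norm (ltW st)) -(ger0_norm (_ : 0 <= x + y)) ?addr_ge0// -!normrM E.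
move=> E'; have xy := normr_ge0 (x - y).
have h1 : `|s - t| * (2 * k^-1) <= `|x - y| * (2 * k).
  apply: (@le_trans _ _ (`|s - t| * (s + t))).
    by apply: ler_wpM2l => //; lra.
  by rewrite E'; apply: ler_wpM2l => //; lra.
have -> : `|s - t| = `|s - t| * (2 * k^-1) * (k / 2).
  by field; rewrite gt_eqF.
apply: (@le_trans _ _ (`|x - y| * (2 * k) * (k / 2))); last first.
  by rewrite le_eqVlt; apply/orP; left; apply/eqP; field.
by apply: ler_wpM2r => //; lra.
Qed.

Lemma negligible_sqrt_sum_preimage (a : R) (N : set R) : 0 <= a ->
  mu.-negligible N -> mu.-negligible [set t | N (Num.sqrt (a + t ^+ 2))].
Proof.
move=> a0 N0; pose g (t : R) := Num.sqrt (a + t ^+ 2).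
pose D k := [set t : R | k.+1%:R^-1 <= t /\ g t <= k.+1%:R].
pose E k := [set t : R | k.+1%:R^-1 <= - t /\ g t <= k.+1%:R].
have k0 k : 0 < k.+1%:R :> R by [].
apply: (@negligibleS _ (measurableTypeR R) R mu
    ([set 0] `|` \bigcup_k ((D k `&` g @^-1` N) `|` (E k `&` g @^-1` N)))).
  move=> t /= Nt; have [->|t0] := eqVneq t 0; [by left|right].
  have tp : 0 < `|t| by rewrite normr_gt0.
  have [m mt] : exists m, `|t|^-1 + g t < m%:R.
    by exists (Num.truncn (`|t|^-1 + g t)).+1; exact: truncnS_gt.
  have ti : 0 <= `|t|^-1 by rewrite invr_ge0.
  have gt0 : 0 <= g t by exact: sqrtr_ge0.
  have mS : m%:R <= m.+1%:R :> R by rewrite ler_nat.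
  have h : m.+1%:R^-1 <= `|t|.
    rewrite -[leRHS]invrK lef_pV2 ?posrE ?invr_gt0//; lra.
  exists m => //; case: (ltrgt0P t) => tt.
  - by left; split => //; split; [move: h; rewrite gtr0_norm|lra].
  - by right; split => //; split; [move: h; rewrite ltr0_norm|lra].
  - by rewrite tt eqxx in t0.
apply: negligibleU.
  by exists [set 0]; split => //; exact: lebesgue_measure_set1.
apply: negligible_bigcup => k; apply: negligibleU.
  apply: (@negligible_expanding_preimage _ _ (k.+1%:R ^+ 2)) => //.
  move=> s t [s1 s2] [t1 t2].
  exact: sqrt_sum_diff.
apply: (@negligible_expanding_preimage _ _ (k.+1%:R ^+ 2)) => //.
move=> s t [s1 s2] [t1 t2].
rewrite /g -(sqrrN s) -(sqrrN t).
have -> : `|s - t| = `|- s - - t| by rewrite -opprD normrN.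
by apply: sqrt_sum_diff => //; rewrite sqrrN.
Qed.

Lemma borel_version (J : R -> R) : leb_measurable J -> (forall s, 0 <= s -> 0 <= J s) ->
  exists Jb : R -> R, [/\ measurable_fun setT Jb, forall s, 0 <= Jb s &
    mu.-negligible [set s | 0 <= s /\ J s != Jb s]].
Proof.
move=> mJ J0.
have H (q : rat) : exists AN : set R * set R,
    [/\ measurable AN.1, mu.-negligible AN.2 & J @^-1` `]ratr q, +oo[ = AN.1 `|` AN.2].
  have : measurable (`]ratr q, +oo[%classic : set R) by exact: measurable_itv.
  move=> /(mJ (@measurableT _ (LebR R))); rewrite setTI.
  rewrite -[X in X _]completed_caratheodory_measurable g_sigma_completed_algebra_genE.
  by move=> [A mA [N nN AN]]; exists (A, N).
have [AN HAN] := choice H.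
have HN (q : rat) : exists M : set R, [/\ measurable M, mu M = 0%E & (AN q).2 `<=` M].
  by have [_ [M [? ? ?]] _] := HAN q; exists M.
have [M HM] := choice HN.
pose N := \bigcup_(k in [set: nat]) (if unpickle k is Some q then M q else set0).
have mN : measurable N.
  apply: bigcupT_measurable => k; case: (unpickle k) => [q|]//; by have [] := HM q.
have N0 : mu.-negligible N.
  apply: negligible_bigcup => k; case: (unpickle k) => [q|].
    by have [? ? ?] := HM q; exists (M q); split.
  exact: negligible_set0.
have MN (q : rat) : M q `<=` N.
  by move=> x Mx; exists (pickle q); [exact: I|rewrite pickleK].
pose G s := J s * \1_(~` N) s.
have mG : measurable_fun setT G.
  apply: (measurability _ (RGenOInfty.measurableE R)) => //.
  move=> /= _ [_ [a ->] <-]; rewrite setTI.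
  have -> : G @^-1` `]a, +oo[ = \bigcup_(q : rat) (if a < ratr q then
      ((AN q).1 `\` N) `|` (if ratr q < 0 :> R then N else set0) else set0).
    apply/seteqP; split => [s /=|s [q _]].
      rewrite in_itv/= andbT /G indicE.
      have [Ns|Ns] := pselect (N s).
        have -> : (s \in ~` N) = false by apply: memNset => /(_ Ns).
        rewrite mulr0 => /rat_in_itvoo[q]; rewrite in_itv/= => /andP[aq q0].
        by exists q => //; rewrite aq; right; rewrite q0.
      rewrite mem_set// mulr1 => /rat_in_itvoo[q]; rewrite in_itv/= => /andP[aq qJ].
      exists q => //; rewrite aq; left; split => //.
      have [_ _] := HAN q; move=> /seteqP[/(_ s) + _].
      rewrite /= in_itv/= andbT => /(_ qJ) [//|N2].
      by have [_ _ /(_ _ N2)/MN] := HM q.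
    case: ifP => // aq [[As Ns]|].
      rewrite /= in_itv/= andbT /G indicE mem_set// mulr1.
      have [_ _] := HAN q; move=> /seteqP[_ /(_ s)]; rewrite /= in_itv/= andbT.
      by move=> /(_ (or_introl As)); exact: lt_trans.
    case: ifP => // q0 Ns; rewrite /= in_itv/= andbT /G indicE.
    have -> : (s \in ~` N) = false by apply: memNset => /(_ Ns).
    by rewrite mulr0; exact: lt_trans q0.
  apply: bigcupT_measurable_rat => q; case: ifP => // _; apply: measurableU.
    by apply: measurableD => //; have [] := HAN q.
  by case: ifP.
exists (fun s => Num.max (G s) 0); split.
- exact: measurable_maxr.
- by move=> s; rewrite le_max lexx orbT.
- apply: negligibleS N0 => s /= [s0 /eqP JG]; apply: contrapT => Ns; apply: JG.
  by rewrite /G indicE mem_set// mulr1 max_l// J0.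
Qed.

End NullSets.

(** * Iterated integrals *)

Section IteratedIntegral.
Context {R : realType}.
Local Notation mu := (@lebesgue_measure R).

Definition sqn {n} (v : 'rV[R]_n) : R := \sum_(i < n) v ord0 i ^+ 2.

Definition tailv {n} (x : 'rV[R]_n.+1) : 'rV[R]_n := \row_i x ord0 (lift ord0 i).

Lemma joinv0 n (s : R) (v : 'rV[R]_n) : joinv s v ord0 ord0 = s.
Proof.
rewrite /joinv (_ : ord0 = lshift n (ord0 : 'I_1)); last exact/val_inj.
by rewrite (@row_mxEl R 1 1 n) mxE.
Qed.

Lemma joinvS n (s : R) (v : 'rV[R]_n) i : joinv s v ord0 (lift ord0 i) = v ord0 i.
Proof.
rewrite /joinv (_ : lift ord0 i = rshift 1 i); last exact/val_inj.
by rewrite (@row_mxEr R 1 1 n).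
Qed.

Lemma eq_row n (x y : 'rV[R]_n.+1) : x ord0 ord0 = y ord0 ord0 ->
  (forall i, x ord0 (lift ord0 i) = y ord0 (lift ord0 i)) -> x = y.
Proof.
move=> h0 hS; apply/rowP => i.
by case: (unliftP ord0 i) => [j ->|->]; [exact: hS|exact: h0].
Qed.

Lemma subr_joinv n (x : 'rV[R]_n.+1) t v :
  x - joinv t v = joinv (x1 x - t) (tailv x - v).
Proof.
have E m (a b : 'rV[R]_m) i : (a - b) ord0 i = a ord0 i - b ord0 i by rewrite !mxE.
by apply: eq_row => [|i]; rewrite E ?joinv0// !joinvS E mxE.
Qed.

Lemma tailv_joinv n s (v : 'rV[R]_n) : tailv (joinv s v) = v.
Proof. by apply/rowP => i; rewrite mxE joinvS. Qed.

Lemma sqn_ge0 n (v : 'rV[R]_n) : 0 <= sqn v.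
Proof. by apply: sumr_ge0 => i _; exact: sqr_ge0. Qed.

Lemma sqn_joinv n t (v : 'rV[R]_n) : sqn (joinv t v) = t ^+ 2 + sqn v.
Proof.
by rewrite /sqn big_ord_recl joinv0; congr (_ + _); apply: eq_bigr => i _; rewrite joinvS.
Qed.

Lemma sqnN n (v : 'rV[R]_n) : sqn (- v) = sqn v.
Proof. by apply: eq_bigr => i _; rewrite mxE sqrrN. Qed.

Lemma enormE n (v : 'rV[R]_n) : enorm v = Num.sqrt (sqn v). Proof. by []. Qed.

Lemma normr_le_enorm n (v : 'rV[R]_n) i : `|v ord0 i| <= enorm v.
Proof.
rewrite -sqrtr_sqr enormE ler_sqrt ?sqn_ge0// /sqn (bigD1 i)//= lerDl.
by apply: sumr_ge0 => j _; exact: sqr_ge0.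
Qed.

Local Open Scope ereal_scope.

Lemma iintS n (g : 'rV[R]_n.+1 -> \bar R) :
  iint g = \int[mu]_t iint (fun v => g (joinv t v)).
Proof. by []. Qed.

Lemma iint_ge0 n (g : 'rV[R]_n -> \bar R) : (forall v, 0 <= g v) -> 0 <= iint g.
Proof.
elim: n g => [|n IH] g g0 //=.
by apply: integral_ge0 => t _; apply: IH.
Qed.

Lemma iint_mono n (g h : 'rV[R]_n -> \bar R) : (forall v, 0 <= g v) ->
  (forall v, g v <= h v) -> iint g <= iint h.
Proof.
elim: n g h => [|n IH] g h g0 gh //=.
by apply: lower_integral_mono => t; [exact: iint_ge0|exact: IH].
Qed.

Lemma iintZl n (k : R) (g : 'rV[R]_n -> \bar R) : (0 <= k)%R -> (forall v, 0 <= g v) ->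
  iint (fun v => k%:E * g v) = k%:E * iint g.
Proof.
move=> k0; elim: n g => [|n IH] g g0 //=.
under eq_integral do rewrite IH//.
by rewrite lower_integralZl// => t; exact: iint_ge0.
Qed.

Lemma iint_reflect n (x : 'rV[R]_n) (g : 'rV[R]_n -> \bar R) : (forall v, 0 <= g v) ->
  iint (fun v => g (x - v)%R) = iint g.
Proof.
elim: n x g => [|n IH] x g g0 /=; first by congr g; apply/rowP => -[].
under eq_integral => t _.
  under [X in iint X]funext => v do rewrite subr_joinv.
  rewrite (IH _ (fun v => g (joinv (x1 x - t) v)))//.
  over.
by rewrite (lower_integral_reflect (x1 x) (fun s => iint (fun v => g (joinv s v))))// => t;
  exact: iint_ge0.
Qed.

Lemma iint_ae_radial n (J Jb : R -> R) (a : R) (x : 'rV[R]_n.+1) (G : 'rV[R]_n.+1 -> R) :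
  (0 <= a)%R -> (forall s, 0 <= s -> 0 <= J s)%R -> (forall s, 0 <= Jb s)%R ->
  (forall y, 0 <= G y)%R -> mu.-negligible [set s | (0 <= s)%R /\ J s != Jb s] ->
  iint (fun y => (J (Num.sqrt (a + sqn (x - y))) * G y)%:E) =
  iint (fun y => (Jb (Num.sqrt (a + sqn (x - y))) * G y)%:E).
Proof.
move=> a0 J0 Jb0 G0 N0; elim: n a x G a0 G0 => [|n IH] a x G a0 G0.
  have sE t : sqn (x - joinv t 0) = ((x1 x - t) ^+ 2)%R.
    by rewrite subr_joinv sqn_joinv /sqn big_ord0 addr0.
  have := negligible_sqrt_sum_preimage _ _ a0 N0.
  move=> /(@negligible_expanding_preimage _ setT (fun t => x1 x - t)%R 1 _ ler01).
  rewrite setTI; set N := _ @^-1` _ => HN.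
  have {}HN : mu.-negligible N.
    apply: HN => s t _ _; rewrite (_ : x1 x - s - (x1 x - t) = t - s)%R; last by ring.
    by rewrite mul1r distrC.
  apply: (lower_integral_ae _ _ N) => // [t|t|t /= Nt].
  - by rewrite lee_fin mulr_ge0// J0// sqrtr_ge0.
  - by rewrite lee_fin mulr_ge0.
  - rewrite sE; congr (_ * _)%:E; apply/eqP/negPn/negP => h; apply: Nt.
    by split => //; exact: sqrtr_ge0.
rewrite 2!iintS; apply: eq_integral => t _.
have := IH (a + (x1 x - t) ^+ 2)%R (tailv x) (fun v => G (joinv t v)).
rewrite addr_ge0 ?sqr_ge0// => /(_ isT (fun v => G0 _)).
have E (I : R -> R) : (fun v : 'rV[R]_n.+1 => (I (Num.sqrt (a + sqn (x - joinv t v))) * G (joinv t v))%:E)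
   = (fun v : 'rV[R]_n.+1 => (I (Num.sqrt (a + (x1 x - t) ^+ 2 + sqn (tailv x - v))) * G (joinv t v))%:E).
  by apply/funext => v; rewrite subr_joinv sqn_joinv addrA.
by rewrite (E J) (E Jb).
Qed.

Lemma measurable_iint_radial n d (T : measurableType d) (H : T * measurableTypeR R -> \bar R) :
  measurable_fun setT H -> (forall p, 0 <= H p) ->
  measurable_fun setT (fun p : T => iint (fun v : 'rV[R]_n => H (p, sqn v))).
Proof.
elim: n d T H => [|n IH] d T H mH H0 /=.
  by apply: measurableT_comp => //; exact: measurable_pair2.
pose H' (q : (T * measurableTypeR R) * measurableTypeR R) :=
  H (q.1.1, (q.1.2 ^+ 2 + q.2)%R).
have mH' : measurable_fun setT H'.
  apply: measurableT_comp => //; apply/measurable_fun_pairP; split => /=.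
    exact: (measurableT_comp measurable_fst measurable_fst).
  apply: measurable_funD => //=.
  apply: measurable_funX.
  exact: (measurableT_comp measurable_snd measurable_fst).
have := measurable_fun_fubini_tonelli_F (m2 := mu) _ (IH _ _ H' mH' (fun _ => H0 _))
  (fun q => iint_ge0 _ _ (fun _ => H0 _)).
rewrite /fubini_F; congr measurable_fun; apply/funext => p.
apply: eq_integral => t _; congr iint; apply/funext => v.
by rewrite /H' /= sqn_joinv.
Qed.

End IteratedIntegral.

(** * The one-dimensional convolution kernel *)

Section RadialKernel.
Context {R : realType} {n : nat}.
Local Notation mu := (@lebesgue_measure R).
Local Notation rV := 'rV[R]_n.+1.

Lemma radial_kernel (J : R -> R) : leb_measurable J -> (forall s, 0 <= s -> 0 <= J s) ->
  exists K : R -> \bar R, [/\ measurable_fun setT K, forall s, (0 <= K s)%E &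
    forall (x : rV) (g : R -> R), (forall t, 0 <= g t) ->
      iint (fun y => (J (enorm (x - y)) * g (x1 y))%:E) =
      (\int[mu]_t (K (x1 x - t)%R * (g t)%:E))%E].
Proof.
move=> mJ J0; have [Jb [mJb Jb0 N0]] := borel_version _ mJ J0.
pose H (p : measurableTypeR R * measurableTypeR R) := (Jb (Num.sqrt (p.1 ^+ 2 + p.2)))%:E.
have H0 p : (0 <= H p)%E by rewrite lee_fin.
pose K (s : R) := iint (fun v : 'rV[R]_n => H (s, sqn v)).
have mH : measurable_fun setT H.
  apply/measurable_EFinP; apply: (measurableT_comp mJb).
  apply: (@measurableT_comp _ _ _ _ _ _ (@Num.sqrt R)).
    by apply: continuous_measurable_fun; exact: sqrt_continuous.
  by apply: measurable_funD => //=; exact: measurable_funX.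
exists K; split.
- exact: measurable_iint_radial.
- by move=> s; apply: iint_ge0 => v; exact: H0.
move=> x g g0.
transitivity (iint (fun y : rV => (Jb (Num.sqrt (0 + sqn (x - y))) * g (x1 y))%:E)).
  rewrite -(@iint_ae_radial _ _ J)//.
  by congr iint; apply/funext => y; rewrite add0r.
rewrite iintS; apply: eq_integral => t _.
have -> : (fun v : 'rV[R]_n => (Jb (Num.sqrt (0 + sqn (x - joinv t v))) * g (x1 (joinv t v)))%:E)
   = (fun v => (g t)%:E * H ((x1 x - t)%R, sqn (tailv x - v)%R))%E.
  apply/funext => v; rewrite -EFinM /= add0r subr_joinv sqn_joinv /x1 joinv0.
  by rewrite mulrC.
rewrite iintZl//.
rewrite [RHS]muleC; congr (_ * _)%E.
rewrite /K -[RHS](iint_reflect _ (tailv x))// => v; exact: H0.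
Qed.

End RadialKernel.

Section Convolution.
Context {R : realType}.
Local Notation mu := (@lebesgue_measure R).
Variable K : R -> \bar R.
Hypothesis mK : measurable_fun setT K.
Hypothesis K0 : forall s, (0 <= K s)%E.
Hypothesis K1 : forall x, (\int[mu]_t (K (x - t)%R * 1%:E) = 1)%E.

Definition bounded_nonneg (g : R -> R) :=
  measurable_fun setT g /\ exists C, forall t, 0 <= g t <= C.

Definition conv (g : R -> R) (x : R) : R := fine (\int[mu]_t (K (x - t)%R * (g t)%:E))%E.

Lemma bounded_nonneg_cst k : 0 <= k -> bounded_nonneg (fun _ => k).
Proof. by move=> k0; split; [exact: measurable_cst|exists k => t; rewrite k0 lexx]. Qed.

Lemma bounded_nonnegD g h : bounded_nonneg g -> bounded_nonneg h ->
  bounded_nonneg (fun t => g t + h t).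
Proof.
move=> [mg [C gC]] [mh [D hD]]; split; first exact: measurable_funD.
by exists (C + D) => t; have /andP[? ?] := gC t; have /andP[? ?] := hD t; rewrite addr_ge0// lerD.
Qed.

Lemma bounded_nonnegZ k g : 0 <= k -> bounded_nonneg g -> bounded_nonneg (fun t => k * g t).
Proof.
move=> k0 [mg [C gC]]; split; first exact: measurable_funM.
by exists (k * C) => t; have /andP[? ?] := gC t; rewrite mulr_ge0// ler_wpM2l.
Qed.

Lemma bounded_nonneg_max g b : bounded_nonneg g -> bounded_nonneg (fun t => Num.max (g t + b) 0).
Proof.
move=> [mg [C gC]]; split.
  by apply: measurable_maxr => //; exact: measurable_funD.
exists (`|C| + `|b|) => t; have /andP[? ?] := gC t; rewrite le_max lexx orbT/=.
rewrite ge_max addr_ge0// andbT; apply: lerD; last exact: ler_norm.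
by apply: le_trans (ler_norm _).
Qed.

Lemma bounded_nonneg_maxN g b : bounded_nonneg g ->
  bounded_nonneg (fun t => Num.max (- (g t + b)) 0).
Proof.
move=> [mg [C gC]]; split.
  apply: measurable_maxr => //; apply: measurable_funN; exact: measurable_funD.
exists `|b| => t; have /andP[? ?] := gC t; rewrite le_max lexx orbT/=.
rewrite ge_max normr_ge0 andbT; have := ler_norm (- b); rewrite normrN; lra.
Qed.

Lemma measurable_conv_integrand g x : measurable_fun setT g ->
  measurable_fun setT (fun t : R => K (x - t)%R * (g t)%:E)%E.
Proof.
move=> mg; apply: emeasurable_funM; last exact/measurable_EFinP.
by apply: (measurableT_comp mK); exact: measurable_funB.
Qed.

Lemma convE g x : bounded_nonneg g ->
  (conv g x)%:E = (\int[mu]_t (K (x - t)%R * (g t)%:E))%E.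
Proof.
move=> [mg [C gC]]; rewrite fineK// ge0_fin_numE; last first.
  by apply: integral_ge0 => t _; rewrite mule_ge0// lee_fin; have /andP[] := gC t.
have C0 : 0 <= C by have /andP[h /(le_trans h)] := gC 0.
apply: (@le_lt_trans _ _ (\int[mu]_t (C%:E * (K (x - t)%R * 1%:E)))%E).
  apply: lower_integral_mono => t; have /andP[? ?] := gC t.
    by rewrite mule_ge0// lee_fin.
  by rewrite mule1 muleC lee_wpmul2r// lee_fin.
rewrite lower_integralZl//; last by move=> t; rewrite mule1.
by rewrite K1 mule1 ltry.
Qed.

Lemma convD g h x : bounded_nonneg g -> bounded_nonneg h ->
  conv (fun t => g t + h t) x = conv g x + conv h x.
Proof.
move=> bg bh; apply: EFin_inj; rewrite EFinD !convE//; last exact: bounded_nonnegD.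
have [mg [C gC]] := bg; have [mh [D hD]] := bh.
have g0 t : 0 <= g t by have /andP[] := gC t.
have h0 t : 0 <= h t by have /andP[] := hD t.
rewrite -ge0_integralD//.
- by apply: eq_integral => t _; rewrite EFinD ge0_muleDr ?lee_fin.
- by move=> t _; rewrite mule_ge0// lee_fin.
- exact: measurable_conv_integrand.
- by move=> t _; rewrite mule_ge0// lee_fin.
- exact: measurable_conv_integrand.
Qed.

Lemma convZ k g x : 0 <= k -> bounded_nonneg g -> conv (fun t => k * g t) x = k * conv g x.
Proof.
move=> k0 bg; apply: EFin_inj; rewrite EFinM !convE//; last exact: bounded_nonnegZ.
have [mg [C gC]] := bg; have g0 t : 0 <= g t by have /andP[] := gC t.
rewrite -lower_integralZl//; last by move=> t; rewrite mule_ge0// lee_fin.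
by apply: eq_integral => t _; rewrite EFinM muleCA.
Qed.

Lemma conv_cst k x : 0 <= k -> conv (fun _ => k) x = k.
Proof.
move=> k0; have := @convZ k (fun _ => 1) x k0 (bounded_nonneg_cst _ ler01).
rewrite mulr1 => ->; rewrite -[RHS]mulr1; congr (_ * _).
by apply: EFin_inj; rewrite convE ?K1//; exact: bounded_nonneg_cst.
Qed.

Lemma conv_posneg W x b : bounded_nonneg W ->
  conv (fun t => Num.max (W t + b) 0) x - conv (fun t => Num.max (- (W t + b)) 0) x =
  conv W x + b.
Proof.
move=> bW; pose b1 := Num.max b 0; pose b2 := Num.max (- b) 0.
have maxE (z : R) : Num.max z 0 = z + Num.max (- z) 0.
  by have [z0|z0] := leP z 0; [rewrite max_l ?subrr// oppr_ge0|rewrite max_r ?addr0// oppr_le0 ltW].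
have b1E : b1 = b + b2 by exact: maxE.
have b10 : 0 <= b1 by rewrite /b1 le_max lexx orbT.
have b20 : 0 <= b2 by rewrite /b2 le_max lexx orbT.
have : conv (fun t => Num.max (W t + b) 0 + b2) x =
       conv (fun t => Num.max (- (W t + b)) 0 + (W t + b1)) x.
  congr conv; apply/funext => t; rewrite b1E maxE; ring.
have bc := bounded_nonneg_cst.
have bb := bounded_nonnegD _ _ bW (bc _ b10).
rewrite !convD//; try exact: bounded_nonneg_max; try exact: bounded_nonneg_maxN;
  try exact: bc; rewrite !conv_cst// b1E => E.
lra.
Qed.

Lemma conv_reflect (g : R -> R) z : (forall t, 0 <= g t) ->
  conv g z = fine (\int[mu]_s (K s * (g (z - s)%R)%:E))%E.
Proof.
move=> g0; congr fine; rewrite -(lower_integral_reflect z) => [|t]; last first.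
  by rewrite mule_ge0// lee_fin.
by apply: eq_integral => t _; rewrite subKr.
Qed.

Lemma conv_shift (g : R -> R) x b : (forall t, 0 <= g t) ->
  conv (fun t => g (t + b)) x = conv g (x + b).
Proof.
move=> g0; rewrite !conv_reflect//; congr fine; apply: eq_integral => s _.
by rewrite addrAC.
Qed.

Lemma conv_nondecreasing g x y : {homo g : s t / s <= t} -> bounded_nonneg g -> x <= y ->
  conv g x <= conv g y.
Proof.
move=> hg bg xy; have [mg [C gC]] := bg.
have g0 t : 0 <= g t by have /andP[] := gC t.
have E z : (conv g z)%:E = (\int[mu]_s (K s * (g (z - s)%R)%:E))%E.
  rewrite convE// -(lower_integral_reflect z); last by move=> t; rewrite mule_ge0// lee_fin.
  by apply: eq_integral => t _; rewrite subKr.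
rewrite -lee_fin !E; apply: lower_integral_mono => t; first by rewrite mule_ge0// lee_fin.
by rewrite lee_wpmul2l// lee_fin hg// lerD2r.
Qed.

End Convolution.

Section NonlocalOperator.
Context {R : realType} {n : nat}.
Local Notation mu := (@lebesgue_measure R).
Local Notation rV := 'rV[R]_n.+1.
Variables (J : R -> R) (K : R -> \bar R) (B : R).
Hypothesis J0 : forall s, 0 <= s -> 0 <= J s.
Hypothesis JB : forall s, 0 <= s -> B < s -> J s = 0.
Hypothesis mK : measurable_fun setT K.
Hypothesis K0 : forall s, (0 <= K s)%E.
Hypothesis JK : forall (x : rV) (g : R -> R), (forall t, 0 <= g t) ->
  iint (fun y => (J (enorm (x - y)) * g (x1 y))%:E) =
  (\int[mu]_t (K (x1 x - t)%R * (g t)%:E))%E.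
Hypothesis J1 : iint (fun z : rV => (Jrad J z)%:E) = 1%E.

Lemma kernel_mass x : (\int[mu]_t (K (x - t)%R * 1%:E) = 1)%E.
Proof.
have := JK (joinv x 0) (fun _ => 1) (fun _ => ler01); rewrite /x1 joinv0 => <-.
rewrite -J1 -[RHS](iint_reflect _ (joinv x 0)); last first.
  by move=> v; rewrite lee_fin J0// sqrtr_ge0.
by congr iint; apply/funext => y; rewrite mulr1.
Qed.

Lemma conv_iint (x : rV) (g : R -> R) : bounded_nonneg g ->
  iint (fun y => (J (enorm (x - y)) * g (x1 y))%:E) = (conv K g (x1 x))%:E.
Proof.
move=> bg; rewrite convE//; last exact: kernel_mass.
by apply: JK => t; have [_ [C /(_ t)/andP[]]] := bg.
Qed.

Lemma conv_J1 (g : R -> R) x : bounded_nonneg g ->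
  (\int[mu]_y (Defs.J1 n J (x - y)%R * (g y)%:E))%E = (conv K g x)%:E.
Proof.
move=> bg; have g0 t : 0 <= g t by have [_ [C /(_ t)/andP[]]] := bg.
have := conv_iint (joinv x 0) g bg; rewrite {2}/x1 joinv0 => <-.
rewrite iintS; apply: eq_integral => t _; rewrite muleC -iintZl//; last first.
  by move=> v; rewrite lee_fin J0// sqrtr_ge0.
congr iint; apply/funext => v; rewrite -EFinM mulrC /x1 joinv0 subr_joinv.
congr (J _ * _)%:E; rewrite !enormE !sqn_joinv; congr (Num.sqrt (_ ^+ 2 + _)).
  by rewrite /x1 joinv0.
by rewrite tailv_joinv sub0r sqnN.
Qed.

Lemma conv_le_local (g h : R -> R) x : bounded_nonneg g -> bounded_nonneg h ->
  (forall t, `|x - t| <= B -> g t <= h t) -> conv K g x <= conv K h x.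
Proof.
move=> bg bh gh; rewrite -lee_fin.
have E k : bounded_nonneg k -> (conv K k x)%:E =
    iint (fun y : rV => (J (enorm (joinv x 0 - y)) * k (x1 y))%:E).
  by move=> bk; rewrite (conv_iint (joinv x 0) k bk) /x1 joinv0.
have g0 t : 0 <= g t by have [_ [C /(_ t)/andP[]]] := bg.
have e0 y : 0 <= enorm (joinv x 0 - y :> rV) by exact: sqrtr_ge0.
rewrite !E//; apply: iint_mono => y; rewrite lee_fin ?mulr_ge0 ?J0//.
have [xyB|/JB ->//] := leP (enorm (joinv x 0 - y)) B; last by rewrite !mul0r.
apply: ler_wpM2l; first exact: J0.
apply: gh; apply: le_trans xyB.
by have := normr_le_enorm _ (joinv x 0 - y) ord0; rewrite mxE joinv0 mxE.
Qed.

Variables (Om : set rV) (delta : rV -> rV -> R) (x : rV).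
Hypothesis JOm : forall y, Om y -> J (delta x y) = J (enorm (x - y)).
Hypothesis JnOm : forall y, ~ Om y -> J (enorm (x - y)) = 0.

Lemma LopE (u : rV -> R) : Lop Om J delta u x =
  (iint (fun y => (J (enorm (x - y)) * Num.max (u y - u x) 0)%:E) -
   iint (fun y => (J (enorm (x - y)) * Num.max (- (u y - u x)) 0)%:E))%E.
Proof.
have maxM a b : 0 <= a -> Num.max (a * b) 0 = a * Num.max b 0 :> R.
  by move=> a0; rewrite maxr_pMr// mulr0.
have E (s : rV -> R) : (fun y => if y \in Om then (Num.max (J (delta x y) * s y) 0)%:E else 0%E) =
    (fun y => (J (enorm (x - y)) * Num.max (s y) 0)%:E).
  apply/funext => y.
  have [Oy|Oy] := pselect (Om y); last by rewrite memNset// JnOm// mul0r.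
  by rewrite mem_set// maxM JOm// J0// sqrtr_ge0.
rewrite /Lop /sintN /intN E -(E (fun y => - (u y - u x))).
by do 3 f_equal; apply/funext => y; rewrite mulrN.
Qed.

Lemma iint_kernel_le (g h : rV -> R) : (forall y, 0 <= g y) ->
  (forall y, Om y -> enorm (x - y) <= B -> g y <= h y) ->
  (iint (fun y => (J (enorm (x - y)) * g y)%:E) <= iint (fun y => (J (enorm (x - y)) * h y)%:E))%E.
Proof.
move=> g0 gh; have e0 y : 0 <= enorm (x - y) by exact: sqrtr_ge0.
apply: iint_mono => y; rewrite lee_fin ?mulr_ge0 ?J0//.
have [Oy|Oy] := pselect (Om y); last by rewrite JnOm// !mul0r.
have [xyB|/JB ->//] := leP (enorm (x - y)) B; last by rewrite !mul0r.
by apply: ler_wpM2l; [exact: J0|exact: gh].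
Qed.

Lemma Lop_le (u : rV -> R) (W : R -> R) m : bounded_nonneg W ->
  (forall y, Om y -> enorm (x - y) <= B -> u y - u x <= W (x1 y) - W (x1 x) + m) ->
  (Lop Om J delta u x <= (conv K W (x1 x) - W (x1 x) + m)%:E)%E.
Proof.
move=> bW uW; rewrite LopE; pose b := m - W (x1 x).
have -> : conv K W (x1 x) - W (x1 x) + m = conv K W (x1 x) + b by rewrite /b; ring.
rewrite -(conv_posneg _ mK K0 kernel_mass)// EFinB -!conv_iint;
  [|exact: bounded_nonneg_maxN|exact: bounded_nonneg_max].
by apply: leeB; apply: iint_kernel_le => [y|y Oy yB]; rewrite ?ge_max !le_max lexx ?orbT//= andbT;
  apply/orP; left; have := uW y Oy yB; rewrite /b; lra.
Qed.

Lemma Lop_ge (u : rV -> R) (W : R -> R) m : bounded_nonneg W ->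
  (forall y, Om y -> enorm (x - y) <= B -> u x - u y <= W (x1 y) - W (x1 x) + m) ->
  ((- (conv K W (x1 x) - W (x1 x) + m))%:E <= Lop Om J delta u x)%E.
Proof.
move=> bW uW; rewrite LopE; pose b := m - W (x1 x).
have -> : conv K W (x1 x) - W (x1 x) + m = conv K W (x1 x) + b by rewrite /b; ring.
rewrite -(conv_posneg _ mK K0 kernel_mass)// opprB EFinB -!conv_iint;
  [|exact: bounded_nonneg_max|exact: bounded_nonneg_maxN].
by apply: leeB; apply: iint_kernel_le => [y|y Oy yB]; rewrite ?ge_max !le_max lexx ?orbT//= andbT;
  apply/orP; left; have := uW y Oy yB; rewrite /b; lra.
Qed.

End NonlocalOperator.

(** * Comparison principle *)

Section Barrier.
Context {R : realType}.

Lemma is_derive_continuous (g dg : R -> R) :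
  (forall t, is_derive t (1 : R) g (dg t)) -> continuous g.
Proof.
by move=> Hg t; apply: differentiable_continuous; apply/derivable1_diffP; apply: ex_derive.
Qed.

Lemma le_barrier (g dg : R -> R) (T0 a t1 : R) :
  (forall t, is_derive t (1 : R) g (dg t)) -> g T0 <= a -> T0 <= t1 ->
  (forall t, T0 < t -> a < g t -> dg t <= 0) -> g t1 <= a.
Proof.
move=> Hg g0 Tt Hdg; rewrite leNgt; apply/negP => gt1.
have cg : continuous g := is_derive_continuous _ _ Hg.
pose S := [set s | T0 <= s <= t1] `&` [set s | g s <= a].
have ST0 : S T0 by split => //=; rewrite lexx Tt.
have Sb : has_ubound S by exists t1 => s [/= /andP[]].
have Scl : closed S.
  apply: closedI; last by apply: (preimage_closed _ (@closed_le _ _)) => y _; exact: cg.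
  rewrite (_ : [set s | _] = `[T0, t1]%classic); first exact: interval_closed.
  by apply/seteqP; split => s; rewrite /= in_itv.
have [/= /andP[Ts0 s0t] gs0] : S (sup S).
  by apply: Scl; apply: closure_sup => //; exists T0.
have s0t' : sup S < t1.
  by rewrite lt_neqAle s0t andbT; apply/eqP => E; move: gs0; rewrite E leNgt gt1.
have cg' : {within `[sup S, t1], continuous g} by apply: continuous_subspaceT => x; exact: cg.
have [xi] := MVT s0t' (fun x _ => Hg x) cg'.
rewrite in_itv/= => /andP[sxi xit] E.
have : a < g xi.
  rewrite ltNge; apply/negP => gxi; move: (sxi); rewrite ltNge => /negP; apply.
  by apply: ub_le_sup => //; split => //=; rewrite (ltW xit) andbT (le_trans Ts0 (ltW sxi)).
move=> /(Hdg _ (le_lt_trans Ts0 sxi)) dxi.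
have : g t1 - g (sup S) <= 0 by rewrite E mulr_le0_ge0// subr_ge0.
lra.
Qed.

End Barrier.

Section Comparison.
Context {R : realType} {n : nat}.
Local Notation rV := 'rV[R]_n.+1.
Variables (E D : set rV) (B : R) (v dv : R -> rV -> R) (F : R -> R) (Lam T0 : R).
Variables (W dW PW : R -> R -> R).
Hypothesis Lam0 : 0 <= Lam.
Hypothesis DE : D `<=` E.
Hypothesis v1 : forall t x, E x -> v t x <= 1.
Hypothesis W0 : forall t s, 0 <= W t s.
Hypothesis Dv : forall t x, D x -> is_derive t (1 : R) (fun s => v s x) (dv t x).
Hypothesis DW : forall t s, is_derive t (1 : R) (fun r => W r s) (dW t s).
Hypothesis v_sub : forall t x m, T0 < t -> D x ->
  (forall y, E y -> enorm (x - y) <= B ->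
    v t y - v t x <= W t (x1 y) - W t (x1 x) + m) ->
  dv t x <= PW t (x1 x) - W t (x1 x) + m + F (v t x).
Hypothesis W_super : forall t s, T0 < t -> W t s <= 1 ->
  PW t s - W t s + F (W t s) <= dW t s.
Hypothesis F_lip : forall a b : R, 0 <= a -> a <= b -> b <= 1 -> F b - F a <= Lam * (b - a).
Hypothesis init : forall x, D x -> v T0 x <= W T0 (x1 x).
Hypothesis bdry : forall t x y, T0 < t -> D x -> E y -> ~ D y -> enorm (x - y) <= B ->
  v t y <= W t (x1 y).

(* With N the supremum of (v - W) exp(- (Lam + 1) (t - T0)), the function g below satisfies
   g' <= N - 2 g wherever g > 0, hence g <= N / 2 for every x, and N <= N / 2. *)
Lemma comparison (t : R) x : T0 <= t -> D x -> v t x <= W t (x1 x).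
Proof.
move=> Tt Dx; rewrite leNgt; apply/negP => Hlt.
pose Gam : R := Lam + 1.
pose g (x : rV) (t : R) : R := (v t x - W t (x1 x)) * expR (- Gam * (t - T0)).
have Ge0 (s : R) : T0 <= s -> expR (- Gam * (s - T0)) <= 1.
  move=> Ts; rewrite -expR0 ler_expR mulNr oppr_le0; apply: mulr_ge0.
    by rewrite /Gam addr_ge0.
  by rewrite subr_ge0.
pose S := [set r | exists t y, [/\ T0 <= t, D y & r = g y t]].
have Sub : has_ubound S.
  exists 1 => _ [s [y [Ts Dy ->]]]; rewrite /g.
  have := Ge0 _ Ts; have := expR_gt0 (- Gam * (s - T0)).
  have := v1 s _ (DE _ Dy); have := W0 s (x1 y).
  move: (expR _) (v s y) (W s _) => p q r *; nra.
have gx : 0 < g x t by rewrite /g mulr_gt0 ?expR_gt0// subr_gt0.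
have gleN (y : rV) (s : R) : T0 <= s -> D y -> g y s <= sup S.
  by move=> Ts Dy; apply: ub_le_sup => //; exists s, y.
have N0 : 0 < sup S by apply: lt_le_trans gx _; exact: gleN.
have key (y : rV) (s : R) : T0 <= s -> D y -> g y s <= sup S / 2.
  move=> Ts Dy.
  pose dg (s : R) : R := (dv s y - dW s (x1 y) - Gam * (v s y - W s (x1 y))) * expR (- Gam * (s - T0)).
  apply: (@le_barrier _ _ dg T0) => //.
  - move=> r; have := Dv r y Dy => ?; have := DW r (x1 y) => ?.
    rewrite /g; apply: is_derive_eq.
    by rewrite /dg /GRing.scale/=; ring.
  - by rewrite /g subrr mulr0 expR0 mulr1; have := init y Dy; lra.
  move=> r Tr gr.
  set p := expR (- Gam * (r - T0)) in gr *.
  have p0 : 0 < p by exact: expR_gt0.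
  have d0 : 0 < v r y - W r (x1 y).
    by have : 0 < g y r by [lra]; rewrite /g -/p pmulr_lgt0.
  have vy1 := v1 r _ (DE _ Dy).
  have Hm z : E z -> enorm (y - z) <= B ->
      v r z - v r y <= W r (x1 z) - W r (x1 y) + (sup S / p - (v r y - W r (x1 y))).
    move=> Ez yz.
    suff : v r z - W r (x1 z) <= sup S / p by lra.
    have [Dz|Dz] := pselect (D z).
      by rewrite ler_pdivlMr//; exact: gleN (ltW Tr) Dz.
    have := bdry _ _ _ Tr Dy Ez Dz yz.
    have : 0 < sup S / p by rewrite divr_gt0.
    lra.
  have h1 := v_sub _ _ _ Tr Dy Hm.
  have h2 := W_super _ _ Tr (_ : W r (x1 y) <= 1); have {}h2 := h2 ltac:(lra).
  have h3 := F_lip _ _ (W0 r (x1 y)) (ltW (_ : W r (x1 y) < v r y)) vy1.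
  have {}h3 := h3 ltac:(lra).
  have : dv r y - dW r (x1 y) - Gam * (v r y - W r (x1 y)) <= sup S / p - 2 * (v r y - W r (x1 y)).
    by rewrite /Gam; lra.
  move=> /(ler_wpM2r (ltW p0)) h4; rewrite /dg; apply: le_trans h4 _.
  rewrite mulrBl divfK ?gt_eqF//; move: gr; rewrite /g -/p; lra.
have : sup S <= sup S / 2.
  by apply: ge_sup; [exists (g x t), t, x|move=> _ [s [y [Ts Dy ->]]]; exact: key].
lra.
Qed.

End Comparison.

(** * Supersolution *)

Section Bump.
Context {R : realType}.

Definition bump (y : R) : R := (1 + y ^+ 2)^-1.

Lemma bump_den (y : R) : 0 < 1 + y ^+ 2.
Proof. by rewrite ltr_pwDl// sqr_ge0. Qed.

Lemma bump_gt0 y : 0 < bump y.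
Proof. by rewrite invr_gt0 bump_den. Qed.

Lemma bumpE y : bump y * (1 + y ^+ 2) = 1.
Proof. by rewrite mulVf// gt_eqF// bump_den. Qed.

Lemma bump_le1 y : bump y <= 1.
Proof. by rewrite invf_le1 ?bump_den// lerDl sqr_ge0. Qed.

Lemma bumpN y : bump (- y) = bump y.
Proof. by rewrite /bump sqrrN. Qed.

Lemma bump_near (y z tau : R) : `|y - z| <= tau -> bump z <= (1 + tau + tau ^+ 2) * bump y.
Proof.
move=> yz; have tau0 : 0 <= tau by exact: le_trans yz.
rewrite /bump ler_pdivlMr ?bump_den// mulrC ler_pdivrMr ?bump_den//.
move: yz; rewrite ler_norml => /andP[h1 h2].
have h3 : (y - z) ^+ 2 <= tau ^+ 2 by nra.
have h4 : 2 * z * (y - z) <= tau * (1 + z ^+ 2).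
  have [z0|z0] := leP 0 z.
    have := mulr_ge0 tau0 (sqr_ge0 (1 - z)); have := mulr_ge0 z0 (_ : 0 <= tau - (y - z)).
    by rewrite subr_ge0 => /(_ h2); lra.
  have h5 : 0 <= tau + (y - z) by lra.
  have := mulr_ge0 tau0 (sqr_ge0 (1 + z)); have := mulr_le0_ge0 (ltW z0) h5; lra.
have := mulr_ge0 (sqr_ge0 tau) (sqr_ge0 z); lra.
Qed.

Lemma is_derive_bump (r d t : R) :
  is_derive t 1 (fun s : R => bump ((s - d) / r)) (- (2 * ((t - d) / r) * bump ((t - d) / r) ^+ 2 / r)).
Proof.
have h : 1 + ((t - d) / r) ^+ 2 != 0 by rewrite gt_eqF// bump_den.
rewrite /bump; apply: is_derive_eq.
by rewrite /GRing.scale/= exprVn; ring.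
Qed.

Lemma bump_slope_le y : 2 * y * bump y ^+ 2 <= bump y.
Proof.
have := bumpE y; have := bump_gt0 y; move: (bump y) => b b0 bE.
have -> : b = b * (b * (1 + y ^+ 2)) by rewrite bE mulr1.
rewrite -subr_ge0 (_ : _ - _ = (b * (1 - y)) ^+ 2 + 0) ?addr0 ?sqr_ge0//.
by rewrite bE; nra.
Qed.

End Bump.

Section Supersolution.
Context {R : realType}.
Variables (K : R -> \bar R) (B : R).
Hypothesis mK : measurable_fun setT K.
Hypothesis K0 : forall s, (0 <= K s)%E.
Hypothesis K1 : forall x, (\int[@lebesgue_measure R]_t (K (x - t)%R * 1%:E) = 1)%E.
Hypothesis K_local : forall g h x, bounded_nonneg g -> bounded_nonneg h ->
  (forall t, `|x - t| <= B -> g t <= h t) -> conv K g x <= conv K h x.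
Variables (F phi dphi : R -> R) (c e kap Lam eta M gam a rho T0 sig : R).
Hypothesis phi01 : forall s, 0 <= phi s <= 1.
Hypothesis Dphi : forall s, is_derive s (1 : R) phi (dphi s).
Hypothesis phi_wave : forall s, c * dphi s = conv K phi s - phi s + F (phi s).
Hypothesis e1 : `|e| = 1.
Hypothesis edphi_ge0 : forall s, 0 <= e * dphi s.
Hypothesis edphi_gam : forall s, `|s| <= M -> gam <= e * dphi s.
Hypothesis phi_tails : forall s, M < `|s| -> phi s <= eta \/ 1 - eta <= phi s.
Hypothesis F_lip : forall p q : R, 0 <= p -> p <= q -> q <= 1 -> F q - F p <= Lam * (q - p).
Hypothesis F_stable : forall p q : R, 0 <= p -> p <= q -> q <= 1 ->
  q <= 2 * eta \/ 1 - 2 * eta <= p -> F q - F p <= - kap * (q - p).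
Hypotheses (c0 : 0 < c) (kap0 : 0 < kap) (Lam0 : 0 <= Lam) (gam0 : 0 < gam).
Hypotheses (a0 : 0 < a) (aeta : 2 * a <= eta) (rho0 : 0 < rho).
Hypothesis a_small : pi * (a * (Lam + kap) * (3 / c + 1) / gam) <= 1 / 2.
Hypothesis M_rho : M <= rho / 2.
Hypothesis B_rho : B / rho + (B / rho) ^+ 2 <= kap / 2.
Hypothesis kap_rho : rho^-1 <= kap / 2.

(* In the transition zone |x + c t + e sig| <= rho the stationary part a bump(x / rho) of the
   perturbation is at most 3 a bump((c t + e sig) / rho), which is integrable in time; the
   drift is the primitive needed to absorb it there, and it stays bounded. *)
Definition drift (t : R) : R := a * (Lam + kap) * rho / gam *
  (3 / c * (atan ((c * t + e * sig) / rho) + pi / 2) + (atan ((t - T0) / rho) + pi / 2)).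

Definition ddrift (t : R) : R := a * (Lam + kap) / gam *
  (3 * bump ((c * t + e * sig) / rho) + bump ((t - T0) / rho)).

Definition supw (t x : R) : R := phi (x + c * t + e * (sig + drift t)) +
  a * (bump (x / rho) + bump ((t - T0) / rho)).

Definition dsupw (t x : R) : R :=
  dphi (x + c * t + e * (sig + drift t)) * (c + e * ddrift t) -
  a * (2 * ((t - T0) / rho) * bump ((t - T0) / rho) ^+ 2 / rho).

Let Lkap0 : 0 < Lam + kap. Proof. exact: ltr_wpDl. Qed.

Lemma is_derive_drift t : is_derive t (1 : R) drift (ddrift t).
Proof.
rewrite /drift; apply: is_derive_eq.
rewrite /GRing.scale/= /ddrift /bump.
have ? : rho != 0 by rewrite gt_eqF.
have ? : c != 0 by rewrite gt_eqF.
have ? : gam != 0 by rewrite gt_eqF.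
set p := (1 + _)^-1; set q := (1 + _)^-1.
by field; apply/and3P; split.
Qed.

Lemma is_derive_supw t x : is_derive t (1 : R) (supw ^~ x) (dsupw t x).
Proof.
have ? := is_derive_drift t; have ? := is_derive_bump rho T0 t.
rewrite /supw; apply: is_derive_eq.
by rewrite /GRing.scale/= /dsupw; ring.
Qed.

Lemma ddrift_ge0 t : 0 <= ddrift t.
Proof.
rewrite /ddrift mulr_ge0//; first by rewrite divr_ge0 ?mulr_ge0 ?ltW.
by rewrite addr_ge0 ?mulr_ge0// ltW// bump_gt0.
Qed.

Lemma drift_bounds t : 0 <= drift t <= rho / 2.
Proof.
have al0 : 0 < a * (Lam + kap) / gam by rewrite divr_gt0 ?mulr_gt0.
have := atan_gtNpi2 ((c * t + e * sig) / rho); have := atan_ltpi2 ((c * t + e * sig) / rho).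
have := atan_gtNpi2 ((t - T0) / rho); have := atan_ltpi2 ((t - T0) / rho).
have c30 : 0 < 3 / c by rewrite divr_gt0.
rewrite /drift; set q := atan ((c * t + e * sig) / rho); set p := atan ((t - T0) / rho).
move=> p1 p2 q1 q2.
have h1 : 0 <= 3 / c * (q + pi / 2) + (p + pi / 2) by nra.
have h2 : 3 / c * (q + pi / 2) + (p + pi / 2) <= pi * (3 / c + 1) by nra.
have -> : a * (Lam + kap) * rho / gam = a * (Lam + kap) / gam * rho by ring.
have h3 : a * (Lam + kap) / gam * (pi * (3 / c + 1)) <= 1 / 2.
  apply: le_trans a_small; rewrite le_eqVlt; apply/orP; left; apply/eqP; ring.
set u := 3 / c * _ + _ in h1 h2 *; set w := pi * (_ + 1) in h2 h3.
move: h1 h2 h3; move: u w (a * _ / _) al0 => u w z z0 u0 uw zw.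
have : z * u <= 1 / 2 by apply: le_trans zw; rewrite ler_pM2l.
have : 0 <= z * u by rewrite mulr_ge0// ltW.
move=> h4 h5; have -> : z * rho * u = z * u * rho by ring.
rewrite mulr_ge0 ?(ltW rho0)//=; have -> : rho / 2 = 1 / 2 * rho by ring.
by rewrite ler_pM2r.
Qed.

Lemma bounded_nonneg_bump : bounded_nonneg (fun x => bump (x / rho)).
Proof.
split; last by exists 1 => t; rewrite ltW ?bump_gt0// bump_le1.
have := is_derive_continuous _ _ (is_derive_bump rho 0).
by under eq_fun do rewrite subr0; move=> /continuous_measurable_fun.
Qed.

Lemma bounded_nonneg_phi b : bounded_nonneg (fun x => phi (x + b)).
Proof.
split; last by exists 1 => t; exact: phi01.
apply: continuous_measurable_fun.
apply: (@is_derive_continuous _ _ (fun x => dphi (x + b))) => x; apply: is_derive_eq.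
by rewrite addr0 mulr1.
Qed.

Lemma supwE t : supw t = (fun x => phi (x + (c * t + e * (sig + drift t))) +
  (a * bump (x / rho) + a * bump ((t - T0) / rho))).
Proof. by apply/funext => x; rewrite /supw (mulrDr a) (addrA x). Qed.

Lemma bounded_nonneg_supw t : bounded_nonneg (supw t).
Proof.
rewrite supwE; apply: bounded_nonnegD; first exact: bounded_nonneg_phi.
apply: bounded_nonnegD; first by apply: bounded_nonnegZ; [exact: ltW|exact: bounded_nonneg_bump].
by apply: bounded_nonneg_cst; rewrite mulr_ge0 ?ltW// bump_gt0.
Qed.

Lemma conv_bump_le x : conv K (fun y => bump (y / rho)) x <= (1 + kap / 2) * bump (x / rho).
Proof.
have k0 : 0 <= (1 + kap / 2) * bump (x / rho).
  by rewrite mulr_ge0// ?ltW ?bump_gt0//; have := kap0; lra.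
rewrite -[leRHS](conv_cst _ K0 K1 _ x k0).
apply: K_local; [exact: bounded_nonneg_bump|exact: bounded_nonneg_cst|move=> t xt].
apply: (le_trans (bump_near (x / rho) _ (B / rho) _)).
  by rewrite -mulrBl normrM (gtr0_norm (_ : 0 < rho^-1)) ?invr_gt0// ler_pM2r ?invr_gt0.
by apply: ler_wpM2r; [rewrite ltW// bump_gt0|rewrite -addrA lerD2l].
Qed.

Lemma supersolution t x : supw t x <= 1 ->
  conv K (supw t) x - supw t x + F (supw t x) <= dsupw t x.
Proof.
move=> w1.
set s := x + c * t + e * (sig + drift t).
set h := bump (x / rho); set k := bump ((t - T0) / rho).
set q := a * (h + k).
have h0 : 0 < h by exact: bump_gt0.
have k0 : 0 < k by exact: bump_gt0.
have q0 : 0 < q by rewrite mulr_gt0// addr_gt0.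
have wE : supw t x = phi s + q by [].
have /andP[ps0 ps1] := phi01 s.
have convw : conv K (supw t) x <= conv K phi s + a * ((1 + kap / 2) * h + k).
  have ak0 : 0 <= a * k by rewrite mulr_ge0// ltW.
  have bb := bounded_nonnegZ _ _ (ltW a0) bounded_nonneg_bump.
  have bc := bounded_nonneg_cst _ ak0.
  rewrite supwE -/k !convD//; last 2 first.
    exact: bounded_nonneg_phi.
    exact: bounded_nonnegD.
  rewrite (conv_shift _ K0 phi)//; last by move=> r; have /andP[] := phi01 r.
  rewrite convZ//; [|exact: ltW|exact: bounded_nonneg_bump].
  rewrite conv_cst// (addrA x) -/s lerD2l mulrDr lerD2r ler_pM2l//.
  exact: conv_bump_le.
have slope : 2 * ((t - T0) / rho) * k ^+ 2 / rho <= kap / 2 * k.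
  apply: (@le_trans _ _ (k / rho)).
    by rewrite ler_pM2r ?invr_gt0//; exact: bump_slope_le.
  by rewrite mulrC ler_pM2r.
have wave := phi_wave s.
have goal : F (phi s + q) - F (phi s) + kap / 2 * q <= e * dphi s * ddrift t.
  have qeta : q <= eta.
    apply: le_trans aeta; rewrite /q mulrC ler_pM2r//.
    by have := bump_le1 (x / rho); have := bump_le1 ((t - T0) / rho); rewrite -/h -/k; lra.
  have psq : phi s <= phi s + q by rewrite lerDl ltW.
  have [sM|sM] := leP `|s| M.
    have := F_lip _ _ ps0 psq w1; rewrite (_ : phi s + q - phi s = q); last by ring.
    move=> FL.
    have hb : h <= 3 * bump ((c * t + e * sig) / rho).
      have -> : 3 * bump ((c * t + e * sig) / rho) =
          (1 + 1 + 1 ^+ 2) * bump (- ((c * t + e * sig) / rho)) by rewrite bumpN; ring.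
      apply: bump_near.
      have -> : - ((c * t + e * sig) / rho) - x / rho = - (s - e * drift t) / rho.
        by rewrite /s; ring.
      rewrite normrM normrN (gtr0_norm (_ : 0 < rho^-1)) ?invr_gt0// ler_pdivrMr// mul1r.
      apply: (le_trans (ler_normB _ _)); rewrite normrM e1 mul1r.
      have /andP[d0 d1] := drift_bounds t; rewrite (ger0_norm d0).
      have := M_rho; lra.
    have : (Lam + kap) * q <= gam * ddrift t.
      have -> : gam * ddrift t = (Lam + kap) * (a * (3 * bump ((c * t + e * sig) / rho) + k)).
        by rewrite /ddrift -/k; field; rewrite gt_eqF.
      rewrite /q; apply: ler_wpM2l; first by rewrite addr_ge0// ltW.
      by rewrite ler_pM2l// lerD2r.
    have : gam * ddrift t <= e * dphi s * ddrift t.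
      by apply: ler_wpM2r; [exact: ddrift_ge0|exact: edphi_gam].
    have := kap0; nra.
  have tails : phi s + q <= 2 * eta \/ 1 - 2 * eta <= phi s.
    by case: (phi_tails _ sM) => ?; [left|right]; lra.
  have := F_stable _ _ ps0 psq w1 tails.
  rewrite (_ : phi s + q - phi s = q); last by ring.
  move=> FS.
  have : 0 <= e * dphi s * ddrift t by rewrite mulr_ge0// ddrift_ge0.
  have := kap0; nra.
rewrite /dsupw -/s -/k wE.
have : a * (2 * ((t - T0) / rho) * k ^+ 2 / rho) <= a * (kap / 2 * k) by rewrite ler_pM2l.
move: goal; rewrite {1 2}/q in convw *; move: (F _) (F _) (2 * _ * _ / _) (ddrift t) wave convw.
rewrite /q; move=> f1 f2 sl dd wave convw goal hsl.
lra.
Qed.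

End Supersolution.

(** * The nonlinearity and the wave profile *)

Section Derivatives.
Context {R : realType}.

Lemma derive_ge0_right (g : R -> R) (x d : R) : is_derive x (1 : R) g d ->
  (forall h, 0 < h -> g x <= g (x + h)) -> 0 <= d.
Proof.
move=> [dg <-] H; pose q (h : R) : R := h^-1 *: (g (h *: (1 : R) + x) - g x).
have qD : q h @[h --> 0^'] --> 'D_1 g x by exact: dg.
rewrite leNgt; apply/negP => D0.
move/cvgrPdist_lt : qD => /(_ (- 'D_1 g x)); rewrite oppr_gt0 => /(_ D0).
move=> -[e /= e0 He].
have e2 : 0 < e / 2 by rewrite divr_gt0.
have := He (e / 2); rewrite /ball/= sub0r normrN gtr0_norm// => /(_ _ _) Hq.
have {Hq} := Hq ltac:(lra) ltac:(by rewrite gt_eqF).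
have : 0 <= q (e / 2).
  rewrite /q /GRing.scale/= mulr1; apply: mulr_ge0; first by rewrite invr_ge0 ltW.
  by rewrite (addrC _ x) subr_ge0 H.
by move=> q0; rewrite ltr_norml => /andP[]; lra.
Qed.

Lemma within_derive_eps (f f' : R -> R) x :
  (fun y => (f y - f x) / (y - x)) @ within [set y | 0 <= y <= 1 /\ y != x] (nbhs x) --> f' x ->
  forall e, 0 < e -> exists2 d, 0 < d & forall y, 0 <= y <= 1 -> y != x -> `|x - y| < d ->
    `|f' x - (f y - f x) / (y - x)| < e.
Proof.
move=> /cvgrPdist_lt H e e0; have := H e e0.
move=> -[d /= d0 Hd].
by exists d => // y y01 yx xyd; apply: (Hd y).
Qed.

Lemma within_derive_interior (f f' : R -> R) x : 0 < x < 1 ->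
  (fun y => (f y - f x) / (y - x)) @ within [set y | 0 <= y <= 1 /\ y != x] (nbhs x) --> f' x ->
  is_derive x (1 : R) f (f' x).
Proof.
move=> /andP[x0 x1] Hf; pose q (h : R) : R := h^-1 *: (f (h *: (1 : R) + x) - f x).
have qD : q h @[h --> 0^'] --> f' x.
  apply/cvgrPdist_lt => e e0.
  have [d d0 Hd] := within_derive_eps _ _ _ Hf _ e0.
  exists (Num.min d (Num.min x (1 - x))) => /=; first by rewrite !lt_min d0 x0 subr_gt0.
  move=> h /=; rewrite /ball/= sub0r normrN !lt_min ltr_norml ltr_norml ltr_norml.
  move=> /andP[/andP[h1 h2] /andP[/andP[h3 h4] /andP[h5 h6]]] hn0.
  have := Hd (h + x); rewrite (_ : x - (h + x) = - h); last by ring.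
  rewrite (_ : h + x - x = h); last by ring.
  rewrite /q /GRing.scale/= mulr1 mulrC => H; apply: H.
  - by apply/andP; split; lra.
  - by apply: contra_neq hn0 => E; lra.
  - by rewrite ltr_norml; apply/andP; split; lra.
have cf : derivable f x 1 by apply/cvg_ex; exists (f' x); exact: qD.
by apply: DeriveDef => //; exact: cvg_lim qD.
Qed.

Lemma within_derive_continuous (f f' : R -> R) (p q : R) :
  (forall x, 0 <= x <= 1 ->
    (fun y => (f y - f x) / (y - x)) @ within [set y | 0 <= y <= 1 /\ y != x] (nbhs x) --> f' x) ->
  0 <= p -> q <= 1 -> {within `[p, q], continuous f}.
Proof.
move=> Hf p0 q1; apply/subspace_continuousP => x; rewrite /= in_itv/= => /andP[px xq].
have x01 : 0 <= x <= 1 by rewrite (le_trans p0 px) (le_trans xq q1).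
apply/cvgrPdist_lt => e e0.
have [d d0 Hd] := within_derive_eps _ _ _ (Hf x x01) _ (@ltr01 R).
have A0 : 0 < `|f' x| + 1 by rewrite ltr_wpDl.
exists (Num.min d (e / (`|f' x| + 1))) => /=; first by rewrite lt_min d0 divr_gt0.
move=> y; rewrite /ball/= lt_min => /andP[yd ye]; rewrite in_itv/= => /andP[py yq].
have [->|yx] := eqVneq y x; first by rewrite subrr normr0.
have y01 : 0 <= y <= 1 by rewrite (le_trans p0 py) (le_trans yq q1).
have := Hd y y01 yx yd => Hq.
have yx0 : y - x != 0 by rewrite subr_eq0.
have -> : f x - f y = - ((f y - f x) / (y - x)) * (y - x) by field.
rewrite normrM normrN.
have h1 : `|(f y - f x) / (y - x)| < `|f' x| + 1.
  have := lerB_dist (f' x - (f' x - (f y - f x) / (y - x))) 0.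
  set Q := _ / _ in Hq *; have -> : Q = f' x - (f' x - Q) by ring.
  move=> _; apply: le_lt_trans (ler_normB _ _) _; by rewrite ltrD2l.
move: ye; rewrite ltr_pdivlMr// distrC => ye.
apply: le_lt_trans ye; rewrite mulrC; apply: ler_wpM2l => //; exact: ltW.
Qed.

Lemma within_derive_le (f f' : R -> R) (p q m : R) :
  (forall x, 0 <= x <= 1 ->
    (fun y => (f y - f x) / (y - x)) @ within [set y | 0 <= y <= 1 /\ y != x] (nbhs x) --> f' x) ->
  0 <= p -> p <= q -> q <= 1 -> (forall s, p < s < q -> f' s <= m) -> f q - f p <= m * (q - p).
Proof.
move=> Hf p0; rewrite le_eqVlt => /predU1P[->|pq] q1 Hm; first by rewrite !subrr mulr0.
have Hd x : x \in `]p, q[%R -> is_derive x (1 : R) f (f' x).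
  rewrite in_itv/= => /andP[px xq].
  by apply: within_derive_interior; [|apply: Hf]; apply/andP; split; lra.
have [xi] := MVT pq Hd (within_derive_continuous _ _ _ _ Hf p0 q1).
rewrite in_itv/= => xi_pq ->; apply: ler_wpM2r; [lra|exact: Hm].
Qed.

End Derivatives.

Section Bistable.
Context {R : realType}.

Lemma bistable_bounds (f f' : R -> R) (theta : R) : A_f f f' theta ->
  exists Lam kap eta : R, [/\ 0 <= Lam, 0 < kap, 0 < eta,
    forall p q : R, 0 <= p -> p <= q -> q <= 1 -> `|f q - f p| <= Lam * (q - p) &
    forall p q : R, 0 <= p -> p <= q -> q <= 1 -> q <= 2 * eta \/ 1 - 2 * eta <= p ->
      f q - f p <= - kap * (q - p)].
Proof.
move=> [Hf [[L HL] [_ [_ [_ [_ [_ [_ [d0 [_ d1]]]]]]]]]].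
pose kap : R := Num.min (- f' 0) (- f' 1) / 2.
have kap0 : 0 < kap by rewrite divr_gt0// lt_min !oppr_gt0 d0 d1.
have k0 : f' 0 <= - 2 * kap.
  by have : Num.min (- f' 0) (- f' 1) <= - f' 0 by [rewrite ge_min lexx]; rewrite /kap; lra.
have k1 : f' 1 <= - 2 * kap.
  by have : Num.min (- f' 0) (- f' 1) <= - f' 1 by [rewrite ge_min lexx orbT]; rewrite /kap; lra.
have LL : L <= `|L| by exact: ler_norm.
have L0 : 0 <= `|L| by [].
have HL' x y : 0 <= x <= 1 -> 0 <= y <= 1 -> `|f' x - f' y| <= `|L| * `|x - y|.
  by move=> hx hy; apply: le_trans (HL x y hx hy) _; apply: ler_wpM2r.
pose eta : R := kap / (2 * (`|L| + 1)).
have L1 : 0 < 2 * (`|L| + 1) by lra.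
have eta0 : 0 < eta by rewrite divr_gt0.
have etaE : (`|L| + 1) * (2 * eta) = kap.
  by rewrite /eta; field; rewrite gt_eqF//; lra.
pose Lam : R := `|f' 0| + `|L|.
have Lam0 : 0 <= Lam by rewrite addr_ge0.
have f'B s : 0 <= s <= 1 -> `|f' s| <= Lam.
  move=> /andP[s0 s1]; have := HL' s 0; rewrite s0 s1 lexx ler01 subr0 => /(_ isT isT).
  rewrite (ger0_norm s0) => h.
  have -> : f' s = f' 0 + (f' s - f' 0) by ring.
  apply: le_trans (ler_normD _ _) _; rewrite lerD2l; apply: le_trans h _.
  by rewrite -[leRHS]mulr1; apply: ler_wpM2l.
exists Lam, kap, eta; split => // p q p0 pq q1.
  rewrite ler_norml; apply/andP; split; last first.
    apply: (within_derive_le _ _ _ _ _ Hf) => // s /andP[ps sq].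
    by apply: le_trans (ler_norm _) (f'B _ _); apply/andP; split; lra.
  have Hf' x : 0 <= x <= 1 -> (fun y => ((fun z => - f z) y - (fun z => - f z) x) / (y - x))
      @ within [set y | 0 <= y <= 1 /\ y != x] (nbhs x) --> (fun z => - f' z) x.
    move=> /Hf /cvgN; apply: cvg_trans; rewrite (_ : (fun y => _) = - (fun y => (f y - f x) / (y - x)))//.
    by apply/funext => y; rewrite fctE/=; ring.
  have := @within_derive_le R _ _ p q Lam Hf' p0 pq q1 => H.
  rewrite lerNl; apply: le_trans (H _); first by rewrite opprB opprK addrC.
  move=> s /andP[ps sq]; apply: (le_trans (ler_norm _)); rewrite normrN; apply: f'B.
  by apply/andP; split; lra.
move=> H; apply: (within_derive_le _ _ _ _ _ Hf) => // s /andP[ps sq].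
have s01 : 0 <= s <= 1 by apply/andP; split; lra.
case: H => [qe|pe].
  have := HL' s 0 s01; rewrite lexx ler01 subr0 => /(_ isT).
  rewrite (ger0_norm (_ : 0 <= s)); last lra.
  rewrite ler_norml => /andP[_ h].
  have : `|L| * s <= kap by rewrite -etaE; apply: ler_pM; lra.
  lra.
have := HL' s 1 s01; rewrite lexx ler01 => /(_ isT).
rewrite distrC (distrC s) (ger0_norm (_ : 0 <= 1 - s)); last lra.
rewrite ler_norml => /andP[h _].
have : `|L| * (1 - s) <= kap by rewrite -etaE; apply: ler_pM; lra.
lra.
Qed.

End Bistable.

Section WaveProfile.
Context {R : realType}.

Lemma wave_tails (phi : R -> R) : {homo phi : x y / x < y} ->
  phi @ -oo --> (0 : R) -> phi @ +oo --> (1 : R) ->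
  (forall s, 0 <= phi s <= 1) /\
  forall e, 0 < e -> exists2 M, 0 < M & forall s, (s <= - M -> phi s <= e) /\ (M <= s -> 1 - e <= phi s).
Proof.
move=> inc /cvgrPdist_lt H0 /cvgrPdist_lt H1.
have tails e : 0 < e -> exists2 M, 0 < M &
    forall s, (s <= - M -> `|phi s| < e) /\ (M <= s -> `|1 - phi s| < e).
  move=> e0; have := H0 e e0; have := H1 e e0.
  move=> [M1 [_ HM1]] [M0 [_ HM0]].
  exists (`|M0| + `|M1| + 1); first by rewrite ltr_wpDl// addr_ge0.
  have n0 := normr_ge0 M0; have n1 := normr_ge0 M1.
  have := ler_norm M1; have := ler_norm (- M0); rewrite normrN => l0 l1 s; split => hs.
    by have := HM0 s; rewrite sub0r normrN; apply; lra.
  by apply: HM1; lra.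
split => [s|e e0]; last first.
  have [M M0 HM] := tails e e0; exists M => // s; have [h1 h2] := HM s; split.
    by move=> /h1; rewrite ltr_norml => /andP[_ /ltW].
  by move=> /h2; rewrite ltr_norml => /andP[_ h]; lra.
apply/andP; split; rewrite leNgt; apply/negP => hs.
  have [M M0 HM] := tails (- phi s) ltac:(lra).
  pose r := Num.min (s - 1) (- M).
  have [/(_ _) h1 _] := HM r; have {}h1 := h1 ltac:(by rewrite ge_min lexx orbT).
  have rs : r < s by rewrite gt_min; apply/orP; left; lra.
  by have := inc _ _ rs; move: h1; rewrite ltr_norml => /andP[? ?]; lra.
have [M M0 HM] := tails (phi s - 1) ltac:(lra).
pose r := Num.max (s + 1) M.
have [_ h1] := HM r; have {}h1 := h1 ltac:(by rewrite le_max lexx orbT).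
have rs : s < r by rewrite lt_max; apply/orP; left; lra.
by have := inc _ _ rs; move: h1; rewrite ltr_norml => /andP[? ?]; lra.
Qed.

Variables (K : R -> \bar R) (f phi dphi : R -> R) (c Lam : R).
Hypothesis K0 : forall s, (0 <= K s)%E.
Hypothesis K1 : forall x, (\int[@lebesgue_measure R]_t (K (x - t)%R * 1%:E) = 1)%E.
Hypothesis phi01 : forall s, 0 <= phi s <= 1.
Hypothesis Dphi : forall s, is_derive s (1 : R) phi (dphi s).
Hypothesis phi_inc : {homo phi : x y / x < y}.
Hypothesis phi_wave : forall s, c * dphi s = conv K phi s - phi s + f (phi s).
Hypothesis f_lip : forall p q : R, 0 <= p -> p <= q -> q <= 1 -> `|f q - f p| <= Lam * (q - p).
Hypotheses (c0 : 0 < c) (Lam0 : 0 <= Lam).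

Lemma wave_slope_ge0 s : 0 <= dphi s.
Proof.
by apply: (derive_ge0_right _ _ _ (Dphi s)) => h h0; rewrite ltW// phi_inc// ltrDl.
Qed.

(* The increments phi(x + h) - phi(x) satisfy c D' >= - (1 + Lam) D, which makes
   exp(k x) D(x) nondecreasing; let h tend to 0. *)
Lemma wave_slope_harnack (k := (1 + Lam) / c) x y : y <= x ->
  expR (k * (y - x)) * dphi y <= dphi x.
Proof.
move=> yx; have phi_nd : {homo phi : s t / s <= t} by exact: (ltW_homo phi_inc).
have bphi : bounded_nonneg phi.
  split; last by exists 1 => t; exact: phi01.
  apply: continuous_measurable_fun; exact: is_derive_continuous Dphi.
have inc h : 0 < h ->
    expR (k * (y - x)) * (phi (y + h) - phi y) <= phi (x + h) - phi x.
  move=> h0.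
  pose G (z : R) : R := - ((phi (z + h) - phi z) * expR (k * z)).
  pose dG (z : R) : R := - ((dphi (z + h) - dphi z + k * (phi (z + h) - phi z)) * expR (k * z)).
  have : G x <= G y.
    apply: (@le_barrier _ G dG y) => // [z|z _ _].
      rewrite /G; apply: is_derive_eq.
      by rewrite /GRing.scale/= /dG; ring.
    rewrite /dG oppr_le0 mulr_ge0 ?expR_ge0//.
    have zh : z <= z + h by rewrite lerDl ltW.
    have /andP[p0 _] := phi01 z; have /andP[_ p1] := phi01 (z + h).
    have /ler_normlP[fl _] := f_lip _ _ p0 (phi_nd _ _ zh) p1.
    have cm := conv_nondecreasing _ K0 K1 _ _ _ phi_nd bphi zh.
    have w1 := phi_wave z; have w2 := phi_wave (z + h).
    rewrite -(pmulr_rge0 _ c0).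
    have -> : c * (dphi (z + h) - dphi z + k * (phi (z + h) - phi z)) =
       c * dphi (z + h) - c * dphi z + (1 + Lam) * (phi (z + h) - phi z).
      by rewrite /k; field; rewrite gt_eqF.
    rewrite w1 w2; lra.
  rewrite /G lerN2 => H.
  have ex := expR_gt0 (k * x).
  rewrite -(ler_pM2r ex); apply: le_trans H.
  rewrite mulrAC -expRD mulrC; have -> : k * (y - x) + k * x = k * y by ring.
  by [].
have d : is_derive 0 (1 : R) (fun z => phi (x + z) - expR (k * (y - x)) * phi (y + z))
    (dphi x - expR (k * (y - x)) * dphi y).
  apply: is_derive_eq.
  by rewrite !addr0 /GRing.scale/=; ring.
rewrite -subr_ge0; apply: (derive_ge0_right _ _ _ d) => h /inc; rewrite add0r !addr0; lra.
Qed.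

Lemma wave_slope_gt0 M : exists2 gam, 0 < gam & forall s, `|s| <= M -> gam <= dphi s.
Proof.
pose k := (1 + Lam) / c.
have k0 : 0 <= k by rewrite divr_ge0 ?ltW// ltr_wpDr.
have MM : - M - 1 < - M by lra.
have [y] := MVT MM (fun x _ => Dphi x) (continuous_subspaceT (is_derive_continuous _ _ Dphi)).
rewrite in_itv/= => /andP[_ yM] E.
have dy : 0 < dphi y.
  have := phi_inc _ _ MM; move: E; rewrite (_ : - M - (- M - 1) = 1); last by ring.
  by rewrite mulr1; lra.
exists (expR (k * (y - M)) * dphi y); first by rewrite mulr_gt0// expR_gt0.
move=> s; rewrite ler_norml => /andP[sM1 sM2].
apply: le_trans (wave_slope_harnack s y _); last lra.
rewrite ler_pM2r// ler_expR; apply: ler_wpM2l => //; lra.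
Qed.

End WaveProfile.

(** * Far field and choice of scales *)

Section FarField.
Context {R : realType} {n : nat}.
Local Notation rV := 'rV[R]_n.+1.

Lemma norm_le_enorm (x : rV) : `|x| <= enorm x.
Proof.
rewrite -[`|x|]/(mx_norm x).
have [->|/mx_norm_neq0[[i j] ->]] := eqVneq (mx_norm x) 0; first exact: sqrtr_ge0.
by rewrite /= (ord1 i); exact: normr_le_enorm.
Qed.

Lemma x1_le_norm (x : rV) : `|x1 x| <= `|x|.
Proof.
rewrite -[`|x|]/(mx_norm x) mx_normrE.
exact: (le_bigmax _ (fun ij : 'I_1 * 'I_n.+1 => `|x ij.1 ij.2|) (ord0, ord0)).
Qed.

Lemma compact_norm_bound (K : set rV) : compact K -> exists2 r, 0 < r & forall y, K y -> `|y| < r.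
Proof.
by move=> /compact_bounded /ex_strict_bound_gt0[r r0 Hr]; exists r.
Qed.

Lemma compact_closed_box (E : set rV) r : closed E -> compact (E `&` [set x | `|x| <= r]).
Proof.
move=> cE; apply: bounded_closed_compact; last first.
  apply: closedI => //; apply: (preimage_closed _ (@closed_le _ _)) => y _.
  exact: norm_continuous.
by exists r; split => [|s rs x [_ /= xr]]; [exact: num_real|exact: le_trans xr (ltW rs)].
Qed.

Variables (K : set rV) (delta : rV -> rV -> R) (J : R -> R) (B r R0 : R).
Hypothesis dE : quasi_euclidean (closure (~` K)) delta.
Hypothesis JB : forall s, 0 <= s -> B < s -> J s = 0.
Hypothesis Kr : forall y, K y -> `|y| < r.
Hypothesis rR0 : r + B <= R0.

Lemma far_notin x y : R0 <= `|x| -> `|x - y| <= B -> (~` K) y.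
Proof.
move=> xR xy /Kr yr; have := ler_normD (x - y) y; rewrite subrK => h.
have : `|x| < B + r by apply: le_lt_trans h _; exact: ler_ltD.
by rewrite ltNge => /negP; apply; apply: le_trans xR; rewrite addrC.
Qed.

Lemma far_kernel x y : 0 <= B -> R0 <= `|x| -> (~` K) y -> J (delta x y) = J (enorm (x - y)).
Proof.
move=> B0 xR Ky; have cl z : (~` K) z -> closure (~` K) z by exact: subset_closure.
have Kx : (~` K) x by apply: (far_notin x) => //; rewrite subrr normr0.
have [_ /(_ x y (cl _ Kx) (cl _ Ky))[seg dxy]] := dE.
have e0 : 0 <= enorm (x - y) by exact: sqrtr_ge0.
have [xyB|xyB] := leP (enorm (x - y)) B; last first.
  by rewrite !JB// ?(le_trans e0)//; exact: lt_le_trans dxy.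
rewrite seg// => _ [t /= + <-]; rewrite in_itv/= => /andP[t0 t1].
apply: cl; apply: (far_notin x) => //.
have -> : x - ((1 - t) *: x + t *: y) = t *: (x - y).
  by rewrite scalerBl scale1r scalerBr opprD opprB addrA [x + _]addrC subrK.
rewrite normrZ (ger0_norm t0); apply: le_trans xyB; apply: le_trans (norm_le_enorm _).
by rewrite ler_piMl.
Qed.

Lemma far_kernel0 x y : R0 <= `|x| -> ~ (~` K) y -> J (enorm (x - y)) = 0.
Proof.
move=> xR Ky; apply: JB; first exact: sqrtr_ge0.
rewrite ltNge; apply/negP => xyB; apply: Ky; apply: (far_notin x) => //.
exact: le_trans (norm_le_enorm _) xyB.
Qed.

End FarField.

Section Scales.
Context {R : realType}.

Lemma bump_ge_half (y : R) : `|y| <= 1 -> 1 / 2 <= bump y.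
Proof.
move=> y1; have y2 : y ^+ 2 <= 1 by rewrite -real_normK ?num_real// expr_le1.
rewrite mul1r /bump lef_pV2 ?posrE ?bump_den//; lra.
Qed.

Lemma exists_rho (M R0 B kap : R) : 0 <= M -> 0 <= R0 -> 1 <= B -> 0 < kap ->
  exists rho : R, [/\ 0 < rho, M <= rho / 2, R0 <= rho,
    B / rho + (B / rho) ^+ 2 <= kap / 2 & rho^-1 <= kap / 2].
Proof.
move=> M0 R00 B1 k0; have i0 : 0 < kap^-1 by rewrite invr_gt0.
pose rho := 2 * M + R0 + B * (4 * kap^-1 + 1).
have B4 : 4 * kap^-1 + 1 <= B * (4 * kap^-1 + 1) by rewrite ler_peMl//; lra.
have rho0 : 0 < rho by rewrite /rho; lra.
have rB : B * (4 * kap^-1 + 1) <= rho by rewrite /rho; lra.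
have h1 : B / rho <= kap / 4.
  rewrite ler_pdivrMr//; apply: le_trans (_ : kap / 4 * (B * (4 * kap^-1 + 1)) <= _).
    have -> : kap / 4 * (B * (4 * kap^-1 + 1)) = B + kap * B / 4.
      by field; rewrite gt_eqF.
    rewrite lerDl divr_ge0// mulr_ge0; lra.
  apply: ler_wpM2l => //; lra.
have h2 : B / rho <= 1.
  rewrite ler_pdivrMr// mul1r; apply: le_trans rB.
  by rewrite ler_peMr//; lra.
have h3 : 0 <= B / rho by rewrite divr_ge0//; lra.
exists rho; split => //.
- by rewrite /rho; lra.
- by rewrite /rho; lra.
- move: (B / rho) h1 h2 h3 => z h1 h2 h3; nra.
- rewrite invf_ple ?posrE//; last by rewrite divr_gt0.
  have -> : (kap / 2)^-1 = 2 * kap^-1 by field; rewrite gt_eqF.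
  lra.
Qed.

End Scales.

(** * Estimates away from the obstacle *)

Section Estimates.
Context {R : realType} {n : nat}.
Local Notation rV := 'rV[R]_n.+1.
Local Notation mu := (@lebesgue_measure R).
Variables (K : set rV) (delta : rV -> rV -> R) (J : R -> R) (k : R -> \bar R) (B r : R).
Local Notation E := (closure (~` K)).
Hypothesis dE : quasi_euclidean E delta.
Hypothesis J0 : forall s, 0 <= s -> 0 <= J s.
Hypothesis JB : forall s, 0 <= s -> B < s -> J s = 0.
Hypothesis B1 : 1 <= B.
Hypothesis mk : measurable_fun setT k.
Hypothesis k0 : forall s, (0 <= k s)%E.
Hypothesis Jk : forall (x : rV) (g : R -> R), (forall t, 0 <= g t) ->
  iint (fun y => (J (enorm (x - y)) * g (x1 y))%:E) =
  (\int[mu]_t (k (x1 x - t)%R * (g t)%:E))%E.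
Hypothesis J1 : iint (fun z : rV => (Jrad J z)%:E) = 1%E.
Hypotheses (r0 : 0 < r) (Kr : forall y, K y -> `|y| < r).
Variables (f phi dphi : R -> R) (c kap Lam eta M gam : R).
Hypothesis phi01 : forall s, 0 <= phi s <= 1.
Hypothesis phi_nd : {homo phi : x y / x <= y}.
Hypothesis phi_tails : forall e, 0 < e -> exists2 M, 0 < M &
  forall s, (s <= - M -> phi s <= e) /\ (M <= s -> 1 - e <= phi s).
Hypothesis Dphi : forall s, is_derive s (1 : R) phi (dphi s).
Hypothesis phi_wave : forall s, c * dphi s = conv k phi s - phi s + f (phi s).
Hypothesis dphi_ge0 : forall s, 0 <= dphi s.
Hypothesis dphi_gam : forall s, `|s| <= M -> gam <= dphi s.
Hypothesis phi_tailsM : forall s, M < `|s| -> phi s <= eta \/ 1 - eta <= phi s.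
Hypothesis f_lip : forall p q : R, 0 <= p -> p <= q -> q <= 1 -> `|f q - f p| <= Lam * (q - p).
Hypothesis f_stable : forall p q : R, 0 <= p -> p <= q -> q <= 1 ->
  q <= 2 * eta \/ 1 - 2 * eta <= p -> f q - f p <= - kap * (q - p).
Hypotheses (c0 : 0 < c) (kap0 : 0 < kap) (Lam0 : 0 <= Lam) (gam0 : 0 < gam) (M0 : 0 <= M).
Variable u : R -> rV -> R.
Hypothesis u01 : forall t x, E x -> 0 <= u t x <= 1.
Hypothesis Du : forall t x, E x -> derivable (fun s => u s x) t 1 /\
  ('D_1 (fun s => u s x) t)%:E = (Lop (~` K) J delta (u t) x + (f (u t x))%:E)%E.
Hypothesis u_past : forall e : R, 0 < e -> exists T : R, forall t x, t <= T -> E x ->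
  `|u t x - phi (x1 x + c * t)| < e.
Variable a : R.
Hypotheses (a0 : 0 < a) (aeta : 2 * a <= eta).
Hypothesis a_small : pi * (a * (Lam + kap) * (3 / c + 1) / gam) <= 1 / 2.

Let k1 := kernel_mass _ _ J0 Jk J1.
Let k_local := conv_le_local _ _ _ J0 JB k0 Jk J1.
Let B0 : 0 <= B. Proof. exact: le_trans ler01 B1. Qed.

Lemma u_derive t x : E x -> is_derive t (1 : R) (fun s => u s x) ('D_1 (fun s => u s x) t).
Proof. by move=> Ex; have [h _] := Du t x Ex; exact: derivableP. Qed.

Lemma bump_box rho R0 (x : rV) : 0 < rho -> R0 <= rho -> `|x| <= R0 -> 1 / 2 <= bump (x1 x / rho).
Proof.
move=> rho0 Rr xR; apply: bump_ge_half; rewrite normrM (gtr0_norm (_ : 0 < rho^-1)) ?invr_gt0//.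
rewrite ler_pdivrMr// mul1r; apply: le_trans (x1_le_norm _) _; exact: le_trans xR Rr.
Qed.

Lemma upper_estimate : exists T0 R0 S : R,
  (forall t x, t <= T0 -> E x -> `|u t x - phi (x1 x + c * t)| < a) /\
  forall t x, T0 <= t -> E x -> R0 <= `|x| -> u t x <= phi (x1 x + c * t + S) + 2 * a.
Proof.
have [T0 HT0] := u_past _ a0; pose R0 : R := r + B.
have R00 : 0 <= R0 by rewrite addr_ge0// ltW.
have [rho [rho0 Mrho Rrho Brho krho]] := exists_rho _ _ _ _ M0 R00 B1 kap0.
have [Ma Ma0 HMa] := phi_tails (a / 2) ltac:(by rewrite divr_gt0).
pose sig : R := Ma + R0 + `|c * T0|.
have sig0 : 0 <= sig by rewrite !addr_ge0// ltW.
pose W := supw phi c 1 kap Lam gam a rho T0 sig.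
have db t := drift_bounds c 1 kap Lam gam a rho T0 sig c0 kap0 Lam0 gam0 a0 rho0 a_small t.
have bW t : bounded_nonneg (W t) by exact: (bounded_nonneg_supw _ _ _ _ _ _ _ _ _ _ _ phi01 Dphi).
have f_lip' p q : 0 <= p -> p <= q -> q <= 1 -> f q - f p <= Lam * (q - p).
  by move=> p0 pq q1; exact: le_trans (ler_norm _) (f_lip _ _ p0 pq q1).
exists T0, R0, (sig + rho / 2); split => // t x Tt Ex xR.
have comp : u t x <= W t (x1 x).
  apply: (@comparison R n E [set x | E x /\ R0 <= `|x|] B u
    (fun t x => 'D_1 (fun s => u s x) t) f Lam T0 W (dsupw dphi c 1 kap Lam gam a rho T0 sig)
    (fun t => conv k (W t))).
  - exact: Lam0.
  - by move=> y [].
  - by move=> s y Ey; have /andP[] := u01 s y Ey.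
  - by move=> s y; have [_ [C /(_ y)/andP[]]] := bW s.
  - by move=> s y [Ey _]; exact: u_derive.
  - move=> s y; exact: (is_derive_supw _ _ _ _ _ _ _ _ _ _ _ Dphi c0 gam0 rho0).
  - move=> s y m _ [Ey yR] H; rewrite -lee_fin (Du s y Ey).2 EFinD leeD2r//.
    apply: (Lop_le _ _ _ J0 JB mk k0 Jk J1) => //.
    + by move=> z Kz; exact: (far_kernel _ _ _ _ _ _ dE JB Kr (lexx _)).
    + by move=> z Kz; exact: (far_kernel0 _ _ _ _ _ JB Kr (lexx _)).
    + by move=> z Kz; apply: H; exact: subset_closure.
  - have e1 : `|1| = 1 :> R by rewrite normr1.
    have ge0 z : 0 <= 1 * dphi z by rewrite mul1r.
    have gg z : `|z| <= M -> gam <= 1 * dphi z by rewrite mul1r; exact: dphi_gam.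
    move=> s y _; exact: (@supersolution R k B mk k0 k1 k_local f phi dphi c 1 kap Lam eta M
      gam a rho T0 sig phi01 Dphi phi_wave e1 ge0 gg phi_tailsM f_lip' f_stable
      c0 kap0 Lam0 gam0 a0 aeta rho0 a_small Mrho Brho krho).
  - exact: f_lip'.
  - move=> y [Ey yR]; have := HT0 T0 y (lexx _) Ey; rewrite ltr_norml => /andP[_ h].
    have /andP[d0 _] := db T0.
    have : phi (x1 y + c * T0) <= phi (x1 y + c * T0 + 1 * (sig + drift c 1 kap Lam gam a rho T0 sig T0)).
      by apply: phi_nd; rewrite lerDl mul1r addr_ge0.
    have b0 : bump ((T0 - T0) / rho) = 1 by rewrite subrr mul0r /bump expr0n/= addr0 invr1.
    rewrite /W /supw b0.
    have : 0 < a * bump (x1 y / rho) by rewrite mulr_gt0// bump_gt0.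
    rewrite [a * (_ + 1)]mulrDr mulr1; lra.
  - move=> s y z Ts _ Ez nD _; have /andP[_ uz1] := u01 s z Ez; apply: le_trans uz1 _.
    have zR : `|z| <= R0 by rewrite leNgt; apply/negP => h; apply: nD; split => //; exact: ltW.
    have hb : a * (1 / 2) <= a * bump (x1 z / rho).
      by rewrite ler_pM2l//; exact: bump_box zR.
    have hk : 0 < a * bump ((s - T0) / rho) by rewrite mulr_gt0// bump_gt0.
    have /andP[d0 _] := db s.
    have [_ hphi] := HMa (x1 z + c * s + 1 * (sig + drift c 1 kap Lam gam a rho T0 sig s)).
    have {}hphi : 1 - a / 2 <= phi (x1 z + c * s + 1 * (sig + drift c 1 kap Lam gam a rho T0 sig s)).
      apply: hphi; have := le_trans (x1_le_norm z) zR; rewrite ler_norml => /andP[z1 _].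
      have : c * T0 <= c * s by rewrite ler_pM2l// ltW.
      by have := ler_norm (- (c * T0)); rewrite normrN mul1r /sig; lra.
    rewrite /W /supw [a * (_ + _)]mulrDr; lra.
  - exact: Tt.
  - by split.
apply: le_trans comp _; rewrite /W /supw; apply: lerD.
  by apply: phi_nd; rewrite lerD2l mul1r lerD2l; have /andP[] := db t.
rewrite mulrC ler_pM2r//; have := bump_le1 (x1 x / rho); have := bump_le1 ((t - T0) / rho); lra.
Qed.

Variable uinf : rV -> R.
Hypothesis uinf01 : forall x, E x -> 0 <= uinf x <= 1.
Hypothesis uinf_far : forall e : R, 0 < e -> exists M : R, forall x, E x -> M <= enorm x ->
  `|uinf x - 1| < e.
Hypothesis u_future : forall C : set rV, compact C -> C `<=` E ->
  forall e : R, 0 < e -> exists T : R, forall t x, T <= t -> C x ->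
    `|u t x - uinf x * phi (x1 x + c * t)| < e.

Lemma lower_estimate : exists T0 T1 R0 S : R,
  [/\ forall t x, t <= T0 -> E x -> `|u t x - phi (x1 x + c * t)| < a,
      forall t x, T0 <= t -> E x -> R0 <= `|x| -> phi (x1 x + c * t - S) - 2 * a <= u t x,
      forall t x, T1 <= t -> E x -> `|x| <= R0 ->
        `|u t x - uinf x * phi (x1 x + c * t)| < a &
      forall x, E x -> R0 <= `|x| -> 1 - a <= uinf x].
Proof.
have [T0 HT0] := u_past _ a0.
have a8 : 0 < a / 8 by rewrite divr_gt0.
have [Ri HRi] := uinf_far _ a8.
pose R0 : R := r + B + `|Ri|.
have rR0 : r + B <= R0 by rewrite lerDl.
have R00 : 0 <= R0 by rewrite !addr_ge0// ltW.
have RiR : Ri + B <= R0.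
  by rewrite /R0 [leRHS]addrC; apply: lerD; [exact: ler_norm|rewrite lerDr ltW].
have [rho [rho0 Mrho Rrho Brho krho]] := exists_rho _ _ _ _ M0 R00 B1 kap0.
have [Ma Ma0 HMa] := phi_tails (a / 8) a8.
have cE : closed E by exact: closed_closure.
have [T2 HT2] := u_future _ (compact_closed_box _ R0 cE) (@subIsetl _ _ _) _ a8.
pose T1 : R := `|T2| + (Ma + R0) / c.
have T1T2 : T2 <= T1.
  by apply: le_trans (ler_norm _) _; rewrite lerDl divr_ge0 ?addr_ge0// ltW.
have cT1 : Ma + R0 <= c * T1.
  rewrite /T1 mulrDr mulrCA divff ?gt_eqF// mulr1 lerDr mulr_ge0// ltW//.
pose sig : R := Ma + R0 + `|c * T1|.
have sig0 : 0 <= sig by rewrite !addr_ge0// ltW.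
pose psi (s : R) : R := 1 - phi s; pose g (s : R) : R := - f (1 - s).
pose W := supw psi c (-1) kap Lam gam a rho T0 sig.
have db t := drift_bounds c (-1) kap Lam gam a rho T0 sig c0 kap0 Lam0 gam0 a0 rho0 a_small t.
have psi01 s : 0 <= psi s <= 1.
  by have /andP[h1 h2] := phi01 s; rewrite /psi; apply/andP; split; lra.
have Dpsi s : is_derive s (1 : R) psi (- dphi s).
  rewrite /psi; apply: is_derive_eq.
  by rewrite add0r mul1r.
have bphi : bounded_nonneg phi.
  split; last by exists 1 => t; exact: phi01.
  apply: continuous_measurable_fun; exact: is_derive_continuous Dphi.
have bpsi : bounded_nonneg psi.
  split; last by exists 1 => t; exact: psi01.
  apply: continuous_measurable_fun; exact: is_derive_continuous Dpsi.
have psi_wave s : c * - dphi s = conv k psi s - psi s + g (psi s).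
  have := convD _ mk k0 k1 _ _ s bpsi bphi; rewrite (_ : (fun t => psi t + phi t) = (fun=> 1)); last first.
    by apply/funext => t; rewrite /psi subrK.
  rewrite (conv_cst _ k0 k1)// => hc; have := phi_wave s.
  rewrite /g /psi (_ : 1 - (1 - phi s) = phi s); last by ring.
  by rewrite mulrN => ->; rewrite /psi in hc *; lra.
have g_lip p q : 0 <= p -> p <= q -> q <= 1 -> g q - g p <= Lam * (q - p).
  move=> p0 pq q1; rewrite /g.
  have := f_lip (1 - q) (1 - p) ltac:(lra) ltac:(lra) ltac:(lra).
  by move=> /(le_trans (ler_norm _)) h; lra.
have g_stable p q : 0 <= p -> p <= q -> q <= 1 ->
    q <= 2 * eta \/ 1 - 2 * eta <= p -> g q - g p <= - kap * (q - p).
  move=> p0 pq q1 pq'; rewrite /g.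
  have := f_stable (1 - q) (1 - p) ltac:(lra) ltac:(lra) ltac:(lra).
  have dj : 1 - p <= 2 * eta \/ 1 - 2 * eta <= 1 - q by case: pq' => h; [right|left]; lra.
  by move=> /(_ dj) h; lra.
have bW t : bounded_nonneg (W t) by exact: (bounded_nonneg_supw _ _ _ _ _ _ _ _ _ _ _ psi01 Dpsi).
exists T0, T1, R0, (sig + rho / 2); split => //; first last.
- move=> x Ex xR; have := HRi x Ex; rewrite ltr_norml.
  have -> : Ri <= enorm x.
    apply: le_trans (norm_le_enorm x); apply: le_trans xR; apply: le_trans RiR.
    by rewrite lerDl.
  by move=> /(_ isT)/andP[h _]; lra.
- move=> t x Tt Ex xR; apply: lt_trans (_ : a / 8 < a); last by lra.
  by apply: HT2 => //; exact: le_trans T1T2 Tt.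
move=> t x Tt Ex xR.
have comp : 1 - u t x <= W t (x1 x).
  apply: (@comparison R n E [set x | E x /\ R0 <= `|x|] B (fun t x => 1 - u t x)
    (fun t x => - 'D_1 (fun s => u s x) t) g Lam T0 W
    (dsupw (fun s => - dphi s) c (-1) kap Lam gam a rho T0 sig)
    (fun t => conv k (W t))).
  - exact: Lam0.
  - by move=> y [].
  - by move=> s y Ey; have /andP[h _] := u01 s y Ey; lra.
  - by move=> s y; have [_ [C /(_ y)/andP[]]] := bW s.
  - move=> s y [Ey _]; have ? := u_derive s y Ey.
    by apply: is_derive_eq; rewrite ?add0r ?mul1r.
  - move=> s y; exact: (is_derive_supw _ _ _ _ _ _ _ _ _ _ _ Dpsi c0 gam0 rho0).
  - move=> s y m _ [Ey yR] H; rewrite /g (_ : 1 - (1 - u s y) = u s y); last by ring.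
    rewrite -lerN2 opprK -lee_fin (Du s y Ey).2 opprD opprK EFinD leeD2r//.
    apply: (Lop_ge _ _ _ J0 JB mk k0 Jk J1) => //.
    + by move=> z Kz; exact: (far_kernel _ _ _ _ _ _ dE JB Kr rR0).
    + by move=> z Kz; exact: (far_kernel0 _ _ _ _ _ JB Kr rR0).
    + move=> z Kz yz; have := H z (@subset_closure _ _ _ Kz) yz.
      by rewrite (_ : 1 - u s z - (1 - u s y) = u s y - u s z); last by ring.
  - have e1 : `|-1| = 1 :> R by rewrite normrN normr1.
    have ge0 z : 0 <= -1 * - dphi z by rewrite mulrNN mul1r.
    have gg z : `|z| <= M -> gam <= -1 * - dphi z by rewrite mulrNN mul1r; exact: dphi_gam.
    have psi_tails z : M < `|z| -> psi z <= eta \/ 1 - eta <= psi z.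
      by move=> /phi_tailsM [h|h]; [right|left]; rewrite /psi; lra.
    move=> s y _; exact: (@supersolution R k B mk k0 k1 k_local g psi (fun s => - dphi s)
      c (-1) kap Lam eta M gam a rho T0 sig psi01 Dpsi psi_wave e1 ge0 gg psi_tails g_lip g_stable
      c0 kap0 Lam0 gam0 a0 aeta rho0 a_small Mrho Brho krho).
  - exact: g_lip.
  - move=> y [Ey yR]; have := HT0 T0 y (lexx _) Ey; rewrite ltr_norml => /andP[h _].
    have /andP[d0 _] := db T0.
    have : phi (x1 y + c * T0 + -1 * (sig + drift c (-1) kap Lam gam a rho T0 sig T0)) <= phi (x1 y + c * T0).
      by apply: phi_nd; rewrite gerDl mulN1r oppr_le0 addr_ge0.
    have b0 : bump ((T0 - T0) / rho) = 1 by rewrite subrr mul0r /bump expr0n/= addr0 invr1.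
    rewrite /W /supw b0 /psi.
    have : 0 < a * bump (x1 y / rho) by rewrite mulr_gt0// bump_gt0.
    rewrite [a * (_ + 1)]mulrDr mulr1; lra.
  - move=> s y z Ts [_ yR] Ez nD yz; have /andP[uz0 uz1] := u01 s z Ez.
    have zR : `|z| <= R0 by rewrite leNgt; apply/negP => h; apply: nD; split => //; exact: ltW.
    have hb : a * (1 / 2) <= a * bump (x1 z / rho).
      by rewrite ler_pM2l//; exact: bump_box zR.
    have hk : 0 < a * bump ((s - T0) / rho) by rewrite mulr_gt0// bump_gt0.
    have := le_trans (x1_le_norm z) zR; rewrite ler_norml => /andP[z1 z2].
    have /andP[d0 _] := db s.
    set xi := x1 z + c * s + -1 * (sig + drift c (-1) kap Lam gam a rho T0 sig s).
    have -> : W s (x1 z) = 1 - phi xi + (a * bump (x1 z / rho) + a * bump ((s - T0) / rho)).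
      by rewrite /W /supw [a * (_ + _)]mulrDr.
    have [sT1|T1s] := leP s T1.
      have [hphi _] := HMa xi.
      have {}hphi : phi xi <= a / 8.
        apply: hphi; have : c * s <= c * T1 by rewrite ler_pM2l.
        have := ler_norm (c * T1); rewrite /xi mulN1r /sig; lra.
      lra.
    have /andP[p0 p1] := phi01 xi.
    have [_ hphi] := HMa (x1 z + c * s).
    have {}hphi : 1 - a / 8 <= phi (x1 z + c * s).
      by apply: hphi; have : c * T1 <= c * s by [rewrite ler_pM2l// ltW]; lra.
    have hz : `|uinf z - 1| < a / 8.
      apply: HRi => //; apply: le_trans (norm_le_enorm z).
      have h1 : `|y| <= `|y - z| + `|z| by rewrite -{1}(subrK z y) ler_normD.
      have h2 := le_trans (norm_le_enorm (y - z)) yz.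
      have h3 : R0 <= B + `|z| by apply: le_trans yR _; apply: le_trans h1 _; rewrite lerD2r.
      by rewrite -(lerD2l B); apply: le_trans h3; rewrite addrC.
    have := HT2 s z (le_trans T1T2 (ltW T1s)) (conj Ez zR).
    have /andP[_ q1] := phi01 (x1 z + c * s).
    have /andP[_ i1] := uinf01 z Ez.
    move: hz; rewrite !ltr_norml => /andP[i2 _] /andP[h _].
    have : uinf z + phi (x1 z + c * s) - 1 <= uinf z * phi (x1 z + c * s).
      rewrite -subr_ge0 (_ : _ - _ = (1 - uinf z) * (1 - phi (x1 z + c * s))); last by ring.
      by rewrite mulr_ge0// subr_ge0.
    lra.
  - exact: Tt.
  - by split.
have : W t (x1 x) <= 1 - phi (x1 x + c * t - (sig + rho / 2)) + 2 * a.
  rewrite /W /supw /psi; apply: lerD.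
    rewrite lerD2l lerN2; apply: phi_nd; rewrite lerD2l mulN1r lerN2 lerD2l.
    by have /andP[] := db t.
  rewrite mulrC ler_pM2r//; have := bump_le1 (x1 x / rho); have := bump_le1 ((t - T0) / rho); lra.
lra.
Qed.

End Estimates.

(* Dimension N = n.+1; Omega = ~` K; closure Omega is written closure (~` K). *)
Theorem theorem2p5 (R : realType) (n : nat)
  (K : set 'rV[R]_n.+1) (delta : 'rV[R]_n.+1 -> 'rV[R]_n.+1 -> R)
  (J f f' : R -> R) (theta alpha : R) (phi : R -> R) (c : R)
  (u : R -> 'rV[R]_n.+1 -> R) (uinf : 'rV[R]_n.+1 -> R) :
  compact K -> connected (~` K) ->
  quasi_euclidean (closure (~` K)) delta ->
  A_f f f' theta ->
  A_J (~` K) J delta ->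
  A_TW n J f phi c ->
  A_5 n J f f' ->
  A_nd (~` K) J f' delta ->
  0 < alpha < 1 -> Besov (~` K) alpha J delta ->
  (* u : bounded entire solution of u_t = Lu + f(u) on R x closure Omega *)
  (forall t x, closure (~` K) x -> 0 <= u t x <= 1) ->
  (forall t x, closure (~` K) x ->
     derivable (fun s => u s x) t 1 /\
     ('D_1 (fun s => u s x) t)%:E = (Lop (~` K) J delta (u t) x + (f (u t x))%:E)%E) ->
  (* |u(t,x) - phi(x_1 + c t)| -> 0 as t -> -oo, uniformly in x *)
  (forall e : R, 0 < e -> exists T : R, forall t x, t <= T -> closure (~` K) x ->
     `|u t x - phi (x1 x + c * t)| < e) ->
  (* u_oo : continuous stationary solution with u_oo -> 1 at infinity *)
  {within closure (~` K), continuous uinf} ->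
  (forall x, closure (~` K) x -> 0 <= uinf x <= 1) ->
  (forall x, closure (~` K) x -> (Lop (~` K) J delta uinf x + (f (uinf x))%:E)%E = 0%E) ->
  (forall e : R, 0 < e -> exists M : R, forall x, closure (~` K) x -> M <= enorm x ->
     `|uinf x - 1| < e) ->
  (* |u(t,x) - u_oo(x) phi(x_1 + c t)| -> 0 as t -> +oo, locally uniformly in x *)
  (forall C : set 'rV[R]_n.+1, compact C -> C `<=` closure (~` K) ->
     forall e : R, 0 < e -> exists T : R, forall t x, T <= t -> C x ->
       `|u t x - uinf x * phi (x1 x + c * t)| < e) ->
  (* conclusion *)
  (forall e : R, 0 < e -> exists A0 : R, forall A, A0 <= A -> forall t x,
     closure (~` K) x -> A <= x1 x + c * t -> `|u t x - uinf x| <= e) /\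
  (forall e : R, 0 < e -> exists A0 : R, forall A, A0 <= A -> forall t x,
     closure (~` K) x -> x1 x + c * t <= - A -> u t x <= e).
Proof.
move=> cK _ dE Af [mJ [J0 [[Bs HBs] [_ [_ [J1 _]]]]]] [c0 [_ [phi_inc [dphi [wave [phi0 phi1]]]]]].
move=> _ _ _ _ u01 Du u_past _ uinf01 _ uinf_far u_future.
pose B : R := `|Bs| + 1.
have B1 : 1 <= B by rewrite lerDr.
have JB s : 0 <= s -> B < s -> J s = 0.
  move=> s0 Bs_s; apply/eqP/negPn/negP => Js.
  have : suppJ J s by apply: subset_closure.
  move=> /HBs /= sB; move: Bs_s; rewrite ltNge => /negP; apply; apply: (le_trans sB).
  by apply: (le_trans (ler_norm _)); rewrite lerDl.
have [k [mk k0 Jk]] := @radial_kernel R n J mJ J0.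
have k1 := kernel_mass _ _ J0 Jk J1.
have [phi01 phi_tails] := wave_tails _ phi_inc phi0 phi1.
have Dphi s : is_derive s (1 : R) phi ('D_1 phi s) by exact: derivableP.
have bphi : bounded_nonneg phi.
  split; last by exists 1 => t; exact: phi01.
  exact: continuous_measurable_fun (is_derive_continuous _ _ Dphi).
have phi_wave s : c * 'D_1 phi s = conv k phi s - phi s + f (phi s).
  by apply: EFin_inj; rewrite wave (conv_J1 _ _ J0 k0 Jk J1).
have phi_nd : {homo phi : x y / x <= y} by exact: (ltW_homo phi_inc).
have [Lam [kap [eta [Lam0 kap0 eta0 f_lip f_stable]]]] := bistable_bounds _ _ _ Af.
have [M M0 HM] := phi_tails _ eta0.
have phi_tailsM s : M < `|s| -> phi s <= eta \/ 1 - eta <= phi s.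
  rewrite ltr_normr; have [h1 h2] := HM s.
  by case/orP => h; [right; apply: h2; exact: ltW|left; apply: h1; rewrite lerNr ltW].
have [gam gam0 dphi_gam] := wave_slope_gt0 _ _ _ _ _ _ k0 k1 phi01 Dphi phi_inc phi_wave f_lip c0 Lam0 M.
have dphi_ge0 := wave_slope_ge0 _ _ Dphi phi_inc.
have [r r0 Kr] := compact_norm_bound _ cK.
pose Q : R := pi * ((Lam + kap) * (3 / c + 1) / gam).
have Q0 : 0 < Q.
  have LK : 0 < Lam + kap by exact: ltr_wpDl.
  have C3 : 0 < 3 / c + 1 by rewrite addr_gt0// divr_gt0.
  by rewrite /Q mulr_gt0 ?pi_gt0// divr_gt0// mulr_gt0.
have choose_a e : 0 < e -> exists a : R, [/\ 0 < a, 3 * a <= e, 2 * a <= eta &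
    pi * (a * (Lam + kap) * (3 / c + 1) / gam) <= 1 / 2].
  move=> e0; pose a : R := Num.min (e / 3) (Num.min (eta / 2) ((2 * Q)^-1)).
  have ae : a <= e / 3 by rewrite ge_min lexx.
  have aeta : a <= eta / 2 by rewrite !ge_min lexx orbT.
  have aQ : a <= (2 * Q)^-1 by rewrite !ge_min lexx !orbT.
  exists a; split.
  - by rewrite !lt_min !divr_gt0//= invr_gt0 mulr_gt0.
  - by rewrite mulrC -ler_pdivlMr.
  - by rewrite mulrC -ler_pdivlMr.
  - have -> : pi * (a * (Lam + kap) * (3 / c + 1) / gam) = a * Q by rewrite /Q; ring.
    have -> : 1 / 2 = (2 * Q)^-1 * Q by field; rewrite gt_eqF.
    by rewrite ler_pM2r.
have upper a (a0 : 0 < a) (h1 : 2 * a <= eta) h2 :=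
  upper_estimate _ _ _ _ _ _ dE J0 JB B1 mk k0 Jk J1 r0 Kr _ _ _ _ _ _ _ _ _ phi01 phi_nd
    phi_tails Dphi phi_wave dphi_ge0 dphi_gam phi_tailsM f_lip f_stable c0 kap0 Lam0 gam0
    (ltW M0) _ u01 Du u_past a a0 h1 h2.
have lower a (a0 : 0 < a) (h1 : 2 * a <= eta) h2 :=
  lower_estimate _ _ _ _ _ _ dE J0 JB B1 mk k0 Jk J1 r0 Kr _ _ _ _ _ _ _ _ _ phi01 phi_nd
    phi_tails Dphi phi_wave dphi_ge0 dphi_gam phi_tailsM f_lip f_stable c0 kap0 Lam0 gam0
    (ltW M0) _ u01 Du u_past a a0 h1 h2 _ uinf01 uinf_far u_future.
clear - c0 u01 uinf01 phi01 phi_tails upper lower choose_a.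
split=> e e0; have [a [a0 ae aeta a_small]] := choose_a e e0.
- have [T0 [T1 [R0 [S [past far near far_uinf]]]]] := lower a a0 aeta a_small.
  have [Ma Ma0 HMa] := phi_tails _ a0.
  exists (Ma + `|S| + `|R0| + c * `|T0| + c * `|T1|) => A AA t x Ex xA.
  have S0 := normr_ge0 S; have SS : S <= `|S| := ler_norm S.
  have R00 := normr_ge0 R0; have RR : R0 <= `|R0| := ler_norm R0.
  have T00 : 0 <= c * `|T0| by rewrite mulr_ge0// ltW.
  have T10 : 0 <= c * `|T1| by rewrite mulr_ge0// ltW.
  have T0T : c * T0 <= c * `|T0| by rewrite ler_pM2l// ler_norm.
  have T1T : c * T1 <= c * `|T1| by rewrite ler_pM2l// ler_norm.
  have /andP[u0 u1] := u01 t x Ex; have /andP[i0 i1] := uinf01 x Ex.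
  have /andP[p0 p1] := phi01 (x1 x + c * t).
  have hphi : 1 - a <= phi (x1 x + c * t) by apply: (HMa _).2; lra.
  have [xR|xR] := leP R0 `|x|.
    have hinf := far_uinf x Ex xR.
    have hu : 1 - 3 * a <= u t x.
      have [Tt|Tt] := leP T0 t; last first.
        by have := past t x (ltW Tt) Ex; rewrite ltr_norml => /andP[h _]; lra.
      have := far t x Tt Ex xR; have : 1 - a <= phi (x1 x + c * t - S) by apply: (HMa _).2; lra.
      lra.
    by rewrite ler_norml; apply/andP; split; lra.
  have xR0 := le_trans (x1_le_norm x) (ltW xR).
  move: xR0; rewrite ler_norml => /andP[_ xr].
  have T1t : T1 <= t by rewrite -(ler_pM2l c0); lra.
  have := near t x T1t Ex (ltW xR); rewrite ltr_norml => /andP[h1 h2].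
  have : uinf x * phi (x1 x + c * t) <= uinf x by rewrite ler_piMr.
  have : uinf x - a <= uinf x * phi (x1 x + c * t).
    have := mulr_ge0 i0 (_ : 0 <= phi (x1 x + c * t) - (1 - a)); rewrite subr_ge0 => /(_ hphi).
    have := ler_wpM2r (ltW a0) i1; lra.
  by move=> h3 h4; rewrite ler_norml; apply/andP; split; lra.
- have [T0 [R0 [S [past far]]]] := upper a a0 aeta a_small.
  have [Ma Ma0 HMa] := phi_tails _ a0.
  exists (Ma + `|S| + `|R0| + c * `|T0| + 1) => A AA t x Ex xA.
  have S0 := normr_ge0 S; have SS : S <= `|S| := ler_norm S.
  have R00 := normr_ge0 R0; have RR : R0 <= `|R0| := ler_norm R0.
  have T00 : 0 <= c * `|T0| by rewrite mulr_ge0// ltW.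
  have T0T : - (c * T0) <= c * `|T0| by rewrite -mulrN ler_pM2l// -normrN ler_norm.
  have [Tt|Tt] := leP t T0.
    have := past t x Tt Ex; rewrite ltr_norml => /andP[_ h].
    have : phi (x1 x + c * t) <= a by apply: (HMa _).1; lra.
    lra.
  have [xR|xR] := leP R0 `|x|.
    have := far t x (ltW Tt) Ex xR; have : phi (x1 x + c * t + S) <= a by apply: (HMa _).1; lra.
    lra.
  have := le_trans (x1_le_norm x) (ltW xR); rewrite ler_norml => /andP[h1 _].
  have : c * T0 <= c * t by rewrite ler_pM2l// ltW.
  lra.
Qed.
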